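(* Let $M$ satisfy $M^2=(1-s)(1-t)$, and put $$\mathrm{OD}=ut^2(\cosh_q(Mu)-1)+\frac{(1-t)M}{1-s}\big(\sinh_D(Mu;q)-Mu\big)+\frac{2t(1-t)}{M}\big(\sinh_q(Mu)-Mu\big),$$ $$\mathrm{ED}=2t(\cosh_q(Mu)-1)+(1-t)\big(\cosh_D(Mu;q)-1\big)+\frac{ut^2(1-s)}{M}\sinh_q(Mu).$$ Then, as formal power series in $u$, $$\mathcal{D}_0(s,t,q,u)=\frac{\mathrm{ED}\,\big(1-t\cosh_q(Mu)\big)+\mathrm{OD}\,\frac{t(1-s)}{M}\sinh_q(Mu)}{1-(s+t)\cosh_q(Mu)+st\,\mathrm{e}_q(Mu)\,\mathrm{e}_q(-Mu)},$$ $$\mathcal{D}_1(s,t,q,u)=\frac{\mathrm{OD}\,\big(1-s\cosh_q(Mu)\big)+\mathrm{ED}\,\frac{s(1-t)}{M}\sinh_q(Mu)}{1-(s+t)\cosh_q(Mu)+st\,\mathrm{e}_q(Mu)\,\mathrm{e}_q(-Mu)}.$$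
   Context: $\mathfrak{B}_n$ is the group of permutations $\pi$ of $\{\pm1,\dots,\pm n\}$ with $\pi(-i)=-\pi(i)$, written $\pi=\pi_1,\dots,\pi_n$ with $\pi_i=\pi(i)$; $\mathfrak{D}_n\subseteq\mathfrak{B}_n$ is the subgroup of those $\pi$ with an even number of negative entries among $\pi_1,\dots,\pi_n$. For $\pi\in\mathfrak{D}_n$ ($n\ge2$) set $\pi_{-1}=-\pi_1$; an index $i\in\{-1,1,2,\dots,n-1\}$ is a descent if $\pi_i>\pi_{|i|+1}$ (so $-1$ is a descent iff $-\pi_1>\pi_2$). $\mathrm{odes}_D(\pi)$ (resp. $\mathrm{edes}_D(\pi)$) is the number of odd (resp. even) descents; the index $-1$ is odd. The type D inversion number is $\mathrm{inv}_D(\pi)=|\{1\le i<j\le n:\pi_i>\pi_j\}|+|\{1\le i<j\le n:-\pi_i>\pi_j\}|$. Define $D_n(s,t,q)=\sum_{\pi\in\mathfrak{D}_n}s^{\mathrm{edes}_D(\pi)}t^{\mathrm{odes}_D(\pi)}q^{\mathrm{inv}_D(\pi)}$, $D_n(1,q)=\sum_{\pi\in\mathfrak{D}_n}q^{\mathrm{inv}_D(\pi)}$ (so $D_0(1,q)=D_1(1,q)=1$), and $$\mathcal{D}_0(s,t,q,u)=\sum_{k>0}D_{2k}(s,t,q)\frac{u^{2k}}{D_{2k}(1,q)},\qquad \mathcal{D}_1(s,t,q,u)=\sum_{k>0}D_{2k+1}(s,t,q)\frac{u^{2k+1}}{D_{2k+1}(1,q)}.$$ $[j]_q=1+q+\cdots+q^{j-1}$,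 $[n]_q!=\prod_{j=1}^n[j]_q$, $\mathrm{e}_q(u)=\sum_{n\ge0}u^n/[n]_q!$, $\cosh_q(u)=\frac{\mathrm{e}_q(u)+\mathrm{e}_q(-u)}2$, $\sinh_q(u)=\frac{\mathrm{e}_q(u)-\mathrm{e}_q(-u)}2$; $\exp_D(u;q)=\sum_{n\ge0}u^n/D_n(1,q)$, $\cosh_D(u;q)=\frac{\exp_D(u;q)+\exp_D(-u;q)}2$, $\sinh_D(u;q)=\frac{\exp_D(u;q)-\exp_D(-u;q)}2$. Here $s,t,q$ are indeterminates and the identities are between formal power series in $u$ over the field $\mathbb{Q}(s,t,q)(M)$. *)

(* Defs.v *)
(* boolp provides the eqType and choiceType structures on power series. *)
From HB Require Import structures.
From mathcomp Require Import all_boot all_order all_fingroup all_algebra.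
From mathcomp Require Import all_field.
From mathcomp Require Import boolp.
From mathcomp Require Import mpoly.

Set Implicit Arguments.
Unset Strict Implicit.
Unset Printing Implicit Defensive.

Import Order.TTheory GRing.Theory Num.Theory.
Local Open Scope ring_scope.

Record fps (K : fieldType) := Fps { fcoef : nat -> K }.

Notation "\fps_ i E" := (Fps (fun i : nat => E))
  (at level 36, E at level 36, i at level 1, format "\fps_ i  E") : ring_scope.

Section FpsRing.
Variable K : fieldType.
Implicit Types f g h : fps K.

HB.instance Definition _ := gen_eqMixin (fps K).
HB.instance Definition _ := gen_choiceMixin (fps K).

Lemma fpsP f g : fcoef f =1 fcoef g <-> f = g.
Proof.
split=> [|-> //]; case: f g => [a] [b] /= ab.
by congr Fps; apply: funext.
Qed.

Definition fpsC (c : K) : fps K := \fps_n (if n == 0 then c else 0).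
Definition fpsX : fps K := \fps_n (n == 1)%:R.

Definition fps_add f g : fps K := \fps_n (fcoef f n + fcoef g n).
Definition fps_opp f : fps K := \fps_n (- fcoef f n).
Definition fps_mul f g : fps K :=
  \fps_n (\sum_(i < n.+1) fcoef f i * fcoef g (n - i)).

Lemma fps_addA : associative fps_add.
Proof. by move=> f g h; apply/fpsP => n /=; rewrite addrA. Qed.

Lemma fps_addC : commutative fps_add.
Proof. by move=> f g; apply/fpsP => n /=; rewrite addrC. Qed.

Lemma fps_add0 : left_id (fpsC 0) fps_add.
Proof. by move=> f; apply/fpsP => n /=; case: ifP; rewrite add0r. Qed.

Lemma fps_addN : left_inverse (fpsC 0) fps_opp fps_add.
Proof. by move=> f; apply/fpsP => n /=; case: ifP; rewrite addNr. Qed.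

HB.instance Definition _ :=
  GRing.isZmodule.Build (fps K) fps_addA fps_addC fps_add0 fps_addN.

Definition fps_trunc n f : {poly K} := \poly_(i < n.+1) fcoef f i.

Lemma fps_mul_trunc n m f g : (m <= n)%N ->
  fcoef (fps_mul f g) m = (fps_trunc n f * fps_trunc n g)`_m.
Proof.
move=> le_mn; rewrite coefM; apply: eq_bigr => i _.
have le_im : (i <= m)%N by rewrite -ltnS.
rewrite !coef_poly !ltnS (leq_trans le_im le_mn).
by rewrite (leq_trans (leq_subr _ _) le_mn).
Qed.

Lemma fps_mulC : commutative fps_mul.
Proof.
by move=> f g; apply/fpsP => n; rewrite !(fps_mul_trunc _ _ (leqnn n)) mulrC.
Qed.

Lemma fps_mulA : associative fps_mul.
Proof.
move=> f g h; apply/fpsP => n.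
transitivity (fps_trunc n f * fps_trunc n g * fps_trunc n h)`_n.
  rewrite -mulrA coefM; apply: eq_bigr => i _.
  by rewrite coef_poly ltn_ord (@fps_mul_trunc n) ?leq_subr.
rewrite coefM; apply: eq_bigr => i _.
by rewrite coef_poly ltnS leq_subr (@fps_mul_trunc n) // -ltnS.
Qed.

Lemma fps_mul1 : left_id (fpsC 1) fps_mul.
Proof.
move=> f; apply/fpsP => n /=; rewrite big_ord_recl /= subn0 mul1r.
by rewrite big1 ?addr0 // => i _; rewrite mul0r.
Qed.

Lemma fps_mulDl : left_distributive fps_mul fps_add.
Proof.
move=> f g h; apply/fpsP => n /=; rewrite -big_split /=.
by apply: eq_bigr => i _; rewrite mulrDl.
Qed.

Lemma fps_1neq0 : fpsC 1 != 0.
Proof.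
apply/eqP => /fpsP /(_ 0%N) /= /eqP.
by rewrite (oner_eq0 K).
Qed.

HB.instance Definition _ := GRing.Zmodule_isComNzRing.Build (fps K)
  fps_mulA fps_mulC fps_mul1 fps_mulDl fps_1neq0.

Definition fps_unit : pred (fps K) := fun f => fcoef f 0 != 0.

(* The first n+1 coefficients of 1 / f, from g_0 = 1 / f_0 and
   f_0 g_m = - (f_m g_0 + ... + f_1 g_(m-1)) for m > 0. *)
Fixpoint fps_inv_seq f (n : nat) : seq K :=
  if n is m.+1 then
    let g := fps_inv_seq f m in
    rcons g (- (fcoef f 0)^-1 * \sum_(i < n) fcoef f (n - i) * g`_i)
  else [:: (fcoef f 0)^-1].

Definition fps_inv f : fps K :=
  if fps_unit f then \fps_n (fps_inv_seq f n)`_n else f.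

Lemma size_fps_inv_seq f n : size (fps_inv_seq f n) = n.+1.
Proof. by elim: n => //= n IHn; rewrite size_rcons IHn. Qed.

Lemma nth_fps_inv_seq f n i : (i <= n)%N ->
  (fps_inv_seq f n)`_i = (fps_inv_seq f i)`_i.
Proof.
elim: n => [|n IHn]; first by rewrite leqn0 => /eqP->.
rewrite leq_eqVlt => /predU1P[-> //|lt_in].
by rewrite /= nth_rcons size_fps_inv_seq lt_in IHn.
Qed.

Lemma fps_mulV : {in fps_unit, left_inverse (1 : fps K) fps_inv *%R}.
Proof.
move=> f f0; have {}f0 : fcoef f 0 != 0 := f0.
apply/fpsP => n; rewrite /fps_inv /fps_unit f0 /=.
case: n => [|n]; first by rewrite big_ord1 /= mulVf.
rewrite big_ord_recr /= subnn nth_rcons size_fps_inv_seq ltnn eqxx.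
rewrite mulrAC mulNr mulVf // mulN1r; apply/eqP; rewrite subr_eq0; apply/eqP.
apply: eq_bigr => i _; rewrite mulrC; congr (_ * _).
by rewrite (@nth_fps_inv_seq f n) // -ltnS.
Qed.

Lemma fps_unitPl f g : g * f = 1 -> f \in fps_unit.
Proof.
move=> /fpsP /(_ 0%N) /=; rewrite big_ord1 /= => fg1.
rewrite unfold_in /fps_unit; apply/eqP => f0; move/eqP: fg1.
by rewrite f0 mulr0 eq_sym oner_eq0.
Qed.

Lemma fps_inv_out : {in [predC fps_unit], fps_inv =1 id}.
Proof.
by move=> f /negP fNu; rewrite /fps_inv; case: ifP => // fu; case: fNu.
Qed.

HB.instance Definition _ := GRing.ComNzRing_hasMulInverse.Build (fps K)
  fps_mulV fps_unitPl fps_inv_out.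

(* fps_dil c f is f(c u). *)
Definition fps_dil (c : K) f : fps K := \fps_n (c ^+ n * fcoef f n).

End FpsRing.

(* (i, false) stands for i + 1 and (i, true) for - (i + 1). *)
Definition letter (n : nat) : finType := ('I_n * bool)%type.

Section SignedPermutations.
Variable n : nat.
Implicit Types (x : letter n) (w : {perm letter n}).

Definition letter_opp x : letter n := (x.1, ~~ x.2).
Definition letter_val x : int :=
  if x.2 then - (x.1.+1)%:Z else (x.1.+1)%:Z.

Definition Bgroup : {set {perm letter n}} :=
  [set w : {perm letter n} | [forall x, w (letter_opp x) == letter_opp (w x)]].

(* w_i for 1 <= i <= n; other i occur only in desD, and only when n < 2. *)
Definition entry w (i : nat) : int :=
  if insub i.-1 is Some k then letter_val (w (k, false)) else 0.

Definition Dgroup : {set {perm letter n}} :=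
  [set w : {perm letter n} in Bgroup |
    ~~ odd #|[set i : 'I_n | entry w i.+1 < 0]|].

(* w_i for i in {-1, 1, ..., n}, with w_(-1) = - w_1. *)
Definition entryD w (i : int) : int :=
  if i == - 1 then - entry w 1 else entry w `|i|%N.

Definition indicesD : seq int := - 1 :: [seq i%:Z | i <- iota 1 n.-1].

Definition desD w : seq int :=
  [seq i <- indicesD | entryD w i > entry w `|i|%N.+1].

Definition odesD w : nat := count (fun i : int => odd `|i|%N) (desD w).
Definition edesD w : nat := count (fun i : int => ~~ odd `|i|%N) (desD w).

(* The pairs (i, j) are 0-based, hence the successors. *)
Definition invD1 w : {set 'I_n * 'I_n} :=
  [set ij : 'I_n * 'I_n |
    (ij.1 < ij.2)%N && (entry w ij.1.+1 > entry w ij.2.+1)].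
Definition invD2 w : {set 'I_n * 'I_n} :=
  [set ij : 'I_n * 'I_n |
    (ij.1 < ij.2)%N && (- entry w ij.1.+1 > entry w ij.2.+1)].
Definition invD w : nat := (#|invD1 w| + #|invD2 w|)%N.

End SignedPermutations.

Section GeneratingFunctions.
Variable K : fieldType.
Implicit Types s t q c : K.

Definition Dpoly (n : nat) s t q : K :=
  \sum_(w in Dgroup n) s ^+ edesD w * t ^+ odesD w * q ^+ invD w.

Definition Dpoly1 (n : nat) q : K := \sum_(w in Dgroup n) q ^+ invD w.

(* The sums over k > 0 of D_{2k}(s,t,q) u^{2k} / D_{2k}(1,q) and of
   D_{2k+1}(s,t,q) u^{2k+1} / D_{2k+1}(1,q). *)
Definition Dgen0 s t q : fps K :=
  \fps_n (if ~~ odd n && (0 < n)%N then Dpoly n s t q / Dpoly1 n q else 0).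

Definition Dgen1 s t q : fps K :=
  \fps_n (if odd n && (1 < n)%N then Dpoly n s t q / Dpoly1 n q else 0).

Definition qint (j : nat) q : K := \sum_(i < j) q ^+ i.
Definition qfact (n : nat) q : K := \prod_(1 <= j < n.+1) qint j q.

Definition exp_q q : fps K := \fps_n (qfact n q)^-1.
Definition cosh_q q : fps K := (exp_q q + fps_dil (- 1) (exp_q q)) / 2.
Definition sinh_q q : fps K := (exp_q q - fps_dil (- 1) (exp_q q)) / 2.

Definition exp_D q : fps K := \fps_n (Dpoly1 n q)^-1.
Definition cosh_D q : fps K := (exp_D q + fps_dil (- 1) (exp_D q)) / 2.
Definition sinh_D q : fps K := (exp_D q - fps_dil (- 1) (exp_D q)) / 2.

End GeneratingFunctions.

(* Q(s,t,q), with s, t, q the variables of index 0, 1, 2. *)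
Definition Qstq : fieldType := {fraction {mpoly rat[3]}}.
Definition s_var : Qstq := tofrac 'X_0.
Definition t_var : Qstq := tofrac 'X_1.
Definition q_var : Qstq := tofrac 'X_2.

(* Main.v *)
From HB Require Import structures.
Require Import Defs.
From mathcomp Require Import all_boot all_order all_fingroup all_algebra.
From mathcomp Require Import all_field ring zify mpoly.

Set Implicit Arguments.
Unset Strict Implicit.
Unset Printing Implicit Defensive.

Import Order.TTheory GRing.Theory Num.Theory.
Local Open Scope ring_scope.

(** Write a descent weight x as x + (1 - x) [ascent].  In a word of length n,
multiply these weights over the positions and expand the product from the right
until a term x is chosen, say at position m: the letters after m then form an
increasing block carrying the factor 1 - x at each inner position, and the
first m letters carry their full product of weights.  Summing over all words
gives a linear recurrence for D_n(s,t,q) / D_n(1,q), because the two parts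
separate:

- [sum_sorted_drop_take]: requiring the last b letters to increase divides a
  q-count of words by [b]_q!, since all rearrangements of these letters have
  the same cross inversions;
- [sum_prefix]: a q-count that looks at the first m letters only is the
  corresponding count for words of length m, times a product that does not
  depend on what is counted.

The choices that reach the left end are the inhomogeneous terms.  The type D
ascents at -1, 1, ..., n - 1 all together leave one even-signed permutation,
hence the coefficients of exp_D.  The ascents at 1, ..., n - 1, or those at
-1, 2, ..., n - 1, leave an increasing word up to the sign of its first letter
and give the two terms in 1 / [n]_q!.  The ascents at 2, ..., n - 1 give the
term in 1 / [n - 1]_q!.

It is convenient to drop the parity condition on signs.  Type D descents and
inversions compare ±w_i with w_j, so the sign of the letter of smaller
absolute value never matters.  In particular they do not see the sign of the
letter ±1; flipping it exchanges the two parities, and for n > 0 the sum over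
even-signed permutations is half of the sum over all signed ones
([sum_Dgroup]).

The weights alternate between t and s along the positions, so a block of
ascents contributes a power of M up to one factor, according to the parities
of its length and of its starting point ([asc_block]).  The recurrence
([ratio_recurrence]) becomes a pair of linear equations with coefficients in
cosh_q(Mu) and sinh_q(Mu),

  D_0 (1 - s cosh_q(Mu)) = ED + D_1 (t (1 - s) / M) sinh_q(Mu),
  D_1 (1 - t cosh_q(Mu)) = OD + D_0 (s (1 - t) / M) sinh_q(Mu),

and Cramer's rule gives the theorem: the determinant is the stated denominator
because e_q(Mu) e_q(-Mu) = cosh_q(Mu)^2 - sinh_q(Mu)^2.  Its constant term
(1 - s)(1 - t) is not zero. *)

(** * Signed words over an alphabet *)

Section SignedWords.
Implicit Types (A p : seq nat) (w : seq int).

Fixpoint signings p : seq (seq int) :=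
  if p is a :: p' then
    [seq x :: w | x <- [:: a%:Z; - a%:Z], w <- signings p']
  else [:: [::]].

(** The alphabet is an arbitrary finite set of positive numbers, not only
1, ..., n: removing a letter stays within this family, so that inductions on
words need no standardization. *)
Definition swords A : seq (seq int) :=
  [seq w | p <- permutations A, w <- signings p].

Lemma mem_signings p w : (w \in signings p) = (map absz w == p).
Proof.
elim: p w => [|a p IHp] [|x w] //.
  by apply/allpairsPdep => -[y [v [_ _]]].
rewrite [map _ _]/= eqseq_cons; apply/allpairsPdep/andP.
  move=> [y [v [y_a v_p [-> ->]]]]; rewrite -IHp v_p; split=> //.
  by move: y_a; rewrite !inE => /orP[] /eqP->; rewrite ?abszN absz_nat.
move=> [/eqP <- w_p]; exists x, w; split; rewrite ?IHp //.
by rewrite !inE; lia.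
Qed.

Lemma mem_swords A w : (w \in swords A) = perm_eq (map absz w) A.
Proof.
apply/allpairsPdep/idP => [[p [v [p_A v_p ->]]]|w_A].
  by move: p_A v_p; rewrite mem_permutations mem_signings => ? /eqP->.
by exists (map absz w), w; rewrite mem_permutations mem_signings.
Qed.

Lemma signings_uniq p : 0%N \notin p -> uniq (signings p).
Proof.
elim: p => // a p IHp; rewrite inE negb_or => /andP[a_gt0 p_gt0].
rewrite /signings -/signings; apply: allpairs_uniq; rewrite ?IHp //.
  by rewrite /= inE andbT; lia.
by move=> [x v] [y w] _ _ [-> ->].
Qed.

Lemma swords_uniq A : 0%N \notin A -> uniq (swords A).
Proof.
move=> A_gt0; apply: allpairs_uniq_dep; first exact: permutations_uniq.
  move=> p; rewrite mem_permutations => /perm_mem A_p.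
  by rewrite signings_uniq // A_p.
move=> _ _ /allpairsPdep[p [v [_ v_p ->]]] /allpairsPdep[p' [v' [_ v_p' ->]]].
rewrite /= => eq_v; move: v_p v_p'; rewrite !mem_signings eq_v.
by move=> /eqP eq_p /eqP eq_p'; rewrite -eq_p -eq_p'.
Qed.

Lemma swords_size A w : w \in swords A -> size w = size A.
Proof. by rewrite mem_swords => /perm_size; rewrite size_map. Qed.

End SignedWords.

Section Sums.
Variable K : comNzRingType.
Implicit Types (A p : seq nat) (w : seq int) (F : seq int -> K).

Lemma sum_swords_front A F : uniq A -> (0 < size A)%N ->
  \sum_(w <- swords A) F w =
  \sum_(a <- A) \sum_(w <- swords (rem a A)) (F (a%:Z :: w) + F (- a%:Z :: w)).
Proof.
move=> uA A_gt0; rewrite big_allpairs_dep (perm_big _ (permutationsE A_gt0)) /=.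
rewrite big_allpairs_dep undup_id //; apply: eq_bigr => a _.
rewrite big_allpairs_dep; apply: eq_bigr => p _.
by rewrite big_cat /= big_map cats0 big_map -big_split.
Qed.

Lemma sum_swords_rev A F : 0%N \notin A ->
  \sum_(w <- swords A) F w = \sum_(w <- swords A) F (rev w).
Proof.
move=> A_gt0; rewrite -(big_map rev xpredT F); apply: perm_big.
apply: uniq_perm; rewrite ?(map_inj_uniq (can_inj revK)) ?swords_uniq // => w.
rewrite -[w in RHS]revK mem_map; last exact: (can_inj revK).
by rewrite !mem_swords map_rev perm_rev.
Qed.

Lemma sum_swords_back A F : uniq A -> 0%N \notin A -> (0 < size A)%N ->
  \sum_(w <- swords A) F w =
  \sum_(a <- A) \sum_(w <- swords (rem a A))
     (F (rcons w a%:Z) + F (rcons w (- a%:Z))).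
Proof.
move=> uA A0 A_gt0; rewrite sum_swords_rev // sum_swords_front //.
apply: eq_bigr => a _; rewrite sum_swords_rev; last first.
  by apply: contra A0; apply: mem_rem.
by apply: eq_bigr => w _; rewrite !rev_cons revK.
Qed.

Definition flip_head w := if w is x :: w' then - x :: w' else [::].

(** The first letter is chosen together with its sign, and both signs occur. *)
Lemma sum_swords_flip A F : uniq A ->
  \sum_(w <- swords A) F w = \sum_(w <- swords A) F (flip_head w).
Proof.
move=> uA; case: (posnP (size A)) => [/size0nil->|A_gt0].
  by rewrite !big_allpairs_dep !big_seq1.
rewrite !sum_swords_front //; apply: eq_bigr => a _; apply: eq_bigr => w _.
by rewrite /= opprK addrC.
Qed.

End Sums.

(** * Inversions of words *)

Section Inversions.
Implicit Types (A : seq nat) (w : seq int).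

Fixpoint invA w : nat :=
  if w is x :: w' then (count (fun y => (y < x)%R) w' + invA w')%N else 0%N.
(** Pairs of positions whose entries have a negative sum: the part of the type D
inversion number that ignores the order of the letters ([perm_invS]). *)
Fixpoint invS w : nat :=
  if w is x :: w' then (count (fun y => (y < - x)%R) w' + invS w')%N else 0%N.
Definition invw w := (invA w + invS w)%N.

(** Counting ordered pairs, with the diagonal, makes the symmetry visible. *)
Lemma invS_double w :
  ((invS w).*2 + count (fun x => (x < - x)%R) w
  = \sum_(x <- w) count (fun y => (y < - x)%R) w)%N.
Proof.
elim: w => [|x w IHw]; first by rewrite big_nil.
rewrite big_cons /= big_split /= -IHw.
have -> : (\sum_(y <- w) (x < - y)%R = count (fun y => (y < - x)%R) w)%N.
  rewrite -sum1_count [RHS]big_mkcond; apply: eq_bigr => y _.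
  by rewrite ltrNr; case: ifP.
rewrite doubleD -addnn -!addnA.
by move: (count _ w) (count _ w) (invS w).*2 => a b c; lia.
Qed.

Lemma perm_invS w w' : perm_eq w w' -> invS w = invS w'.
Proof.
move=> eq_w; apply: double_inj.
apply: (@addIn (count (fun x => (x < - x)%R) w)).
rewrite invS_double (seq.permP eq_w) invS_double (perm_big _ eq_w) /=.
by apply: eq_bigr => x _; rewrite (seq.permP eq_w).
Qed.

Lemma invA_rcons w y :
  (invA (rcons w y) = invA w + count (fun x => (y < x)%R) w)%N.
Proof. by elim: w => //= x w ->; rewrite -cats1 count_cat /=; lia. Qed.

Lemma invS_rcons w y :
  (invS (rcons w y) = invS w + count (fun x => (y < - x)%R) w)%N.
Proof. by elim: w => //= x w ->; rewrite -cats1 count_cat /=; lia. Qed.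

Lemma sorted_invA w : sorted <=%R w -> invA w = 0%N.
Proof.
elim: w => //= x w IHw x_w; rewrite IHw ?(path_sorted x_w) // addn0.
apply/eqP; rewrite eqn0Ngt -has_count -all_predC.
by apply: sub_all (order_path_min le_trans x_w) => y /=; rewrite leNgt.
Qed.

End Inversions.

(** * Rank sums and the distribution of inversions on permutations *)

Section RankSums.
Variables (K : fieldType) (q : K).

(** The numbers of smaller elements are 0, ..., n - 1 in some order. *)
Lemma sum_rank d (T : orderType d) (A : seq T) : uniq A ->
  \sum_(a <- A) q ^+ count (fun b => (b < a)%O) A = qint (size A) q.
Proof.
move=> uA; have eqA := permEl (perm_sort <=%O A); rewrite -(perm_big _ eqA) /=.
under eq_bigr do rewrite -(seq.permP eqA).
rewrite -(perm_size eqA); set B := sort _ A.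
have sB : sorted <%O B by rewrite lt_sorted_uniq_le sort_uniq uA sort_le_sorted.
elim: B sB => [|x B IHB] sB; first by rewrite big_nil /qint big_ord0.
have x_B : all (> x)%O B by apply: (order_path_min lt_trans).
rewrite big_cons /qint big_ord_recl /= ltxx.
have -> : count (fun b => (b < x)%O) B = 0%N.
  apply/eqP; rewrite eqn0Ngt -has_count -all_predC.
  by apply: sub_all x_B => y /= /ltW; rewrite leNgt.
congr (_ + _); rewrite big_seq.
under eq_bigr => y yB do rewrite (allP x_B _ yB) exprS.
rewrite -big_seq -mulr_sumr IHB ?(path_sorted sB) // /qint mulr_sumr.
by apply: eq_bigr => i _; rewrite exprS.
Qed.

Lemma qfactS n : qfact n.+1 q = qint n.+1 q * qfact n q.
Proof. by rewrite /qfact big_nat_recr //= mulrC. Qed.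

Lemma qfact0 : qfact 0 q = 1.
Proof. by rewrite /qfact big_geq. Qed.

Lemma count_rem_lt (T : eqType) (e : rel T) (A : seq T) a : irreflexive e ->
  count (e^~ a) (rem a A) = count (e^~ a) A.
Proof.
move=> irr_e; have [a_A|aA] := boolP (a \in A); last by rewrite rem_id.
by rewrite (seq.permP (perm_to_rem a_A)) /= irr_e.
Qed.

(** MacMahon's theorem; the first letter of a word creates as many inversions as
there are smaller letters. *)
Lemma sum_inv_permutations (v : seq int) : uniq v ->
  \sum_(w <- permutations v) q ^+ invA w = qfact (size v) q.
Proof.
have [n] := ubnP (size v); elim: n v => // n IHn v; rewrite ltnS => le_vn uv.
case: (posnP (size v)) => [/size0nil->|v_gt0].
  by rewrite big_seq1 qfact0.
rewrite (perm_big _ (permutationsE v_gt0)) /= big_allpairs_dep undup_id //.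
have -> : size v = (size v).-1.+1 by rewrite prednK.
rewrite qfactS prednK // -sum_rank // mulr_suml big_seq [RHS]big_seq.
apply: eq_bigr => x x_v.
rewrite -(size_rem x_v) -IHn ?rem_uniq ?size_rem //; last by rewrite prednK.
rewrite mulr_sumr big_seq [RHS]big_seq; apply: eq_bigr => w.
rewrite mem_permutations => eq_w; rewrite /= exprD; congr (q ^+ _ * _).
by rewrite (seq.permP eq_w) (@count_rem_lt _ (fun y x => y < x)).
Qed.

End RankSums.

(** * Sorting the last block of a word *)

Section SortedBlock.
Variables (K : fieldType) (q : K).
Implicit Types (A : seq nat) (w : seq int).

(** Group the words by the set of their signed letters: each group is the set of
permutations of its only increasing word, and MacMahon's theorem applies. *)
Lemma sum_sorted_block A (f : seq int -> K) : uniq A -> 0%N \notin A ->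
    (forall v v', perm_eq v v' -> f v = f v') ->
  qfact (size A) q * \sum_(w <- swords A) (sorted <=%R w)%:R * f w =
  \sum_(w <- swords A) f w * q ^+ invA w.
Proof.
move=> uA A0 fP.
pose R v w := sorted <=%R v && perm_eq v w.
transitivity (\sum_(w <- swords A) \sum_(v <- swords A | R v w)
                f w * q ^+ invA w); last first.
  apply: eq_big_seq => w w_A; rewrite -big_filter.
  have -> : [seq v <- swords A | R v w] = [:: sort <=%R w].
    apply: perm_small_eq; rewrite //; apply: uniq_perm => // [|v].
      by rewrite filter_uniq ?swords_uniq.
    rewrite mem_filter inE; apply/andP/eqP => [[/andP[sv eq_vw] _]|->].
      rewrite -(sorted_sort le_trans sv); apply/perm_sortP; rewrite //;
        by [apply: le_total | apply: le_trans | apply: le_anti].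
    rewrite /R sort_le_sorted perm_sort perm_refl; split=> //.
    move: w_A; rewrite !mem_swords; apply: perm_trans.
    by rewrite perm_map // perm_sort.
  by rewrite big_seq1.
rewrite (exchange_big_dep xpredT) //= mulr_sumr; apply: eq_big_seq => v v_A.
rewrite /R; case: (sorted _ _) => /=; last by rewrite big_pred0 // mul0r mulr0.
rewrite mul1r -(swords_size v_A) -sum_inv_permutations; last first.
  apply: (@map_uniq _ _ absz).
  by rewrite (perm_uniq (_ : perm_eq _ A)) // -mem_swords.
rewrite mulrC mulr_sumr -[RHS]big_filter.
have eq_r : perm_eq [seq w <- swords A | perm_eq v w] (permutations v).
  apply: uniq_perm => [||w]; rewrite ?filter_uniq ?swords_uniq //.
    exact: permutations_uniq.
  rewrite mem_filter mem_permutations perm_sym mem_swords.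
  apply: andb_idr => eq_wv; move: v_A; rewrite mem_swords; apply: perm_trans.
  by rewrite perm_map.
rewrite (perm_big _ eq_r); apply: eq_big_seq => w.
by rewrite mem_permutations => /fP->.
Qed.

(** The case m = 0 is [sum_sorted_block].  Reading off the first letter lowers
m: the inversions that it creates depend on the set of the letters behind it
only, and can be moved into [f]. *)
Lemma sum_sorted_drop m A (f : seq int -> K) :
    uniq A -> 0%N \notin A -> (m <= size A)%N ->
    (forall u v v', size u = m -> perm_eq v v' -> f (u ++ v) = f (u ++ v')) ->
  qfact (size A - m) q *
    \sum_(w <- swords A) (sorted <=%R (drop m w))%:R * f w * q ^+ invA w =
  \sum_(w <- swords A) f w * q ^+ invA w.
Proof.
elim: m => [|m IHm] in A f * => uA A0 le_mA fP.
  have fS v v' : perm_eq v v' -> f v = f v' by apply: (fP [::]).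
  rewrite subn0 -(sum_sorted_block uA A0 fS).
  congr (_ * _); apply: eq_bigr => w _; rewrite drop0.
  by case sw: (sorted _ _); rewrite ?mul0r // sorted_invA // mulr1.
have A_gt0 : (0 < size A)%N by apply: leq_trans le_mA.
rewrite !sum_swords_front // mulr_sumr; apply: eq_big_seq => a a_A.
have szA : size (rem a A) = (size A).-1 by rewrite size_rem.
have stepA x : qfact (size A - m.+1) q * \sum_(w <- swords (rem a A))
    (sorted <=%R (drop m.+1 (x :: w)))%:R * f (x :: w) * q ^+ invA (x :: w) =
  \sum_(w <- swords (rem a A)) f (x :: w) * q ^+ invA (x :: w).
  have := IHm (rem a A) (fun w => f (x :: w) * q ^+ count (fun y => y < x) w).
  rewrite szA -subn1 -subnDA add1n => IH; rewrite /= in IH *.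
  under [X in _ * X]eq_bigr do rewrite exprD mulrA -[_ * f _ * _]mulrA.
  under [RHS]eq_bigr do rewrite exprD mulrA.
  apply: IH; rewrite ?rem_uniq //; first by apply: contra A0; apply: mem_rem.
    by rewrite leq_subRL.
  move=> u v v' sz_u eq_v; congr (_ * q ^+ _); last first.
    by rewrite !count_cat (seq.permP eq_v).
  by apply: (fP (x :: u)); rewrite //= sz_u.
by rewrite !big_split mulrDr !stepA.
Qed.

(** The negative pairs counted by [invS] do not change when the block is sorted,
so the previous lemma extends to type D inversions. *)
Lemma sum_sorted_drop_take m A (g : seq int -> K) :
    uniq A -> 0%N \notin A -> (m <= size A)%N ->
  qfact (size A - m) q *
    \sum_(w <- swords A)
       (sorted <=%R (drop m w))%:R * g (take m w) * q ^+ invw w =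
  \sum_(w <- swords A) g (take m w) * q ^+ invw w.
Proof.
move=> uA A0 le_mA; rewrite /invw.
under [X in _ * X]eq_bigr do rewrite addnC exprD mulrA -[_ * g _ * _]mulrA.
under [RHS]eq_bigr do rewrite addnC exprD mulrA.
apply: sum_sorted_drop => // u v v' sz_u eq_v; congr (g _ * q ^+ _).
  by rewrite !take_size_cat.
by apply: perm_invS; rewrite perm_cat2l.
Qed.

End SortedBlock.

(** * Standardizing a prefix *)

Section Prefix.
Variables (K : fieldType) (q : K).
Implicit Types (A : seq nat) (w : seq int).

(** The weight of the choice of the last letter in a signed word of length
k + 1; see [sum_prefix]. *)
Definition Bfactor k : K := (1 + q ^+ k) * qint k.+1 q.
Definition Bfact n : K := \prod_(0 <= k < n) Bfactor k.

(** The left-hand side is the number of type D inversions that a last letter a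
forms with w; the next lemma is its analogue for - a. *)
Lemma count_absz_gt (a : nat) w :
  (count (fun x => a%:Z < x)%R w + count (fun x => a%:Z < - x)%R w =
   count (fun b => a < b) (map absz w))%N.
Proof. by elim: w => //= x w IHw; rewrite -IHw; lia. Qed.

Lemma count_absz_lt (a : nat) w : a \notin map absz w ->
  (count (fun x => - a%:Z < x)%R w + count (fun x => - a%:Z < - x)%R w =
   size w + count (fun b => b < a) (map absz w))%N.
Proof.
by elim: w => //= x w IHw; rewrite inE negb_or => /andP[ax /IHw]; lia.
Qed.

(** Remove the last letter.  A last letter a among k + 1 letters is in one type
D inversion with each letter of larger absolute value; a last letter - a is in
one with every letter, and in a second one with each letter of smaller absolute
value.  By [sum_rank] the two signs contribute [k + 1]_q and q^k [k + 1]_q. *)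
Lemma sum_prefix m (g : seq int -> K) (c : K) :
    (forall A, uniq A -> 0%N \notin A -> size A = m ->
       \sum_(w <- swords A) g w * q ^+ invw w = c) ->
  forall A, uniq A -> 0%N \notin A -> (m <= size A)%N ->
    \sum_(w <- swords A) g (take m w) * q ^+ invw w =
    c * \prod_(m <= k < size A) Bfactor k.
Proof.
move=> g_c A uA A0 le_mA; have [d sizeA] : exists d, size A = (d + m)%N.
  by exists (size A - m)%N; rewrite subnK.
elim: d => [|d IHd] in A uA A0 sizeA le_mA *.
  rewrite sizeA big_geq // mulr1 -(g_c A) //.
  apply: eq_big_seq => w /swords_size.
  by rewrite sizeA => sz_w; rewrite take_oversize // sz_w.
rewrite addSn in sizeA; rewrite sum_swords_back // ?sizeA //.
pose e a := (count (fun b => a < b)%N A, count (fun b => b < a)%N A).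
transitivity (\sum_(a <- A) (q ^+ (e a).1 + q ^+ (d + m) * q ^+ (e a).2) *
  (c * \prod_(m <= k < d + m) Bfactor k)).
  apply: eq_big_seq => a a_A; have szA : size (rem a A) = (d + m)%N.
    by rewrite size_rem // sizeA.
  rewrite -{2}szA -IHd ?rem_uniq ?szA ?leq_addl //; last first.
    by apply: contra A0; apply: mem_rem.
  rewrite mulr_sumr; apply: eq_big_seq => w w_A.
  have sz_w := swords_size w_A; rewrite mem_swords in w_A.
  have take_w x : take m (rcons w x) = take m w.
    by rewrite -cats1 takel_cat // sz_w szA leq_addl.
  have invE x : invw (rcons w x) = (invw w + (count (fun y => (x < y)%R) w
      + count (fun y => (x < - y)%R) w))%N.
    by rewrite /invw invA_rcons invS_rcons addnACA.
  rewrite !take_w !invE count_absz_gt.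
  have aw : a \notin map absz w by rewrite (perm_mem w_A) mem_rem_uniqF.
  rewrite count_absz_lt // !(seq.permP w_A) sz_w szA.
  rewrite (@count_rem_lt _ ltn) ?(@count_rem_lt _ gtn) //; try exact: ltnn.
  by rewrite /e /= !exprD; ring.
rewrite -mulr_suml big_nat_recr ?leq_addl //= [in RHS]mulrA [RHS]mulrC.
congr (_ * _).
rewrite /Bfactor mulrDl mul1r -sizeA -(sum_rank q uA) big_split /= mulr_sumr.
congr (_ + _); rewrite sum_rank //.
(* Ranks from above are ranks from below for the opposite numbers. *)
pose N (a : nat) := - a%:Z; have N_inj : injective N by move=> a b /oppr_inj[].
rewrite -(size_map N A) -(@sum_rank _ q _ _ (map N A)) ?map_inj_uniq // big_map.
apply: eq_bigr => a _; rewrite count_map; congr (q ^+ _).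
by apply: eq_count => b /=; rewrite /N ltrN2 ltz_nat.
Qed.

Lemma sum_invw A : uniq A -> 0%N \notin A ->
  \sum_(w <- swords A) q ^+ invw w = Bfact (size A).
Proof.
move=> uA A0; have := @sum_prefix 0 (fun=> 1) 1 _ A uA A0 isT.
rewrite mul1r -/(Bfact _) => <- => [|A' _ _ /size0nil->].
  by apply: eq_bigr => w _; rewrite mul1r.
by rewrite big_allpairs_dep !big_seq1 mulr1.
Qed.

Lemma sum_prefix_ratio m (g : seq int -> K) (c : K) :
    Bfact m != 0 ->
    (forall A, uniq A -> 0%N \notin A -> size A = m ->
       \sum_(w <- swords A) g w * q ^+ invw w = c) ->
  forall A, uniq A -> 0%N \notin A -> (m <= size A)%N ->
    \sum_(w <- swords A) g (take m w) * q ^+ invw w =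
    c * Bfact (size A) / Bfact m.
Proof.
move=> Bm0 g_c A uA A0 le_mA; rewrite (sum_prefix g_c) // /Bfact.
rewrite (big_cat_nat (leq0n m) le_mA) /= -!/(Bfact _).
by rewrite [Bfact m * _]mulrC mulrA mulfK.
Qed.

End Prefix.

(** * Splitting a word at its last block of ascents *)

Section LastBlock.
Variables (K : fieldType) (q : K) (c : nat -> K).
Implicit Types (A : seq nat) (w : seq int).

(** Position 0 carries the descent -1, which compares - w_1 with w_2. *)
Definition wt_head w : K := if w`_1 < - w`_0 then c 0%N else 1.
Definition wt_step w i : K := if w`_i < w`_i.-1 then c i else 1.
Definition descent_weight k w : K := wt_head w * \prod_(1 <= i < k) wt_step w i.

(** Expand y_(n-1), y_(n-2), ... in turn until the summand c is chosen, at m. *)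
Lemma prod_last_block (y a : nat -> K) n : (forall i, y i = c i + a i) ->
  (0 < n)%N ->
  \prod_(1 <= i < n) y i = \prod_(1 <= i < n) a i +
    \sum_(1 <= m < n)
       (\prod_(1 <= i < m) y i) * c m * \prod_(m.+1 <= i < n) a i.
Proof.
move=> yE; elim: n => // -[_ _|n IHn _]; first by rewrite !big_geq ?addr0.
rewrite big_nat_recr //= [y _]yE mulrDr [X in _ + X * a _]IHn //.
rewrite mulrDl addrC -addrA.
congr (_ + _); first by rewrite [RHS]big_nat_recr.
rewrite [in RHS]big_nat_recr //= (big_geq (leqnn _)) mulr1; congr (_ + _).
rewrite mulr_suml; apply: eq_big_nat => m /andP[_ lt_mn].
by rewrite [in RHS]big_nat_recr //= mulrA.
Qed.

Lemma prod_sorted_drop m n w : size w = n ->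
  \prod_(m.+1 <= i < n) (~~ (w`_i < w`_i.-1))%:R =
  (sorted <=%R (drop m w))%:R :> K.
Proof.
move=> sz_w; have [/(sortedP 0) sw|/(sortedP 0) nsw] := boolP (sorted _ _).
  rewrite big_nat big1 // => i /andP[lt_mi lt_in]; rewrite -leNgt.
  have := sw (i - m.+1)%N; rewrite size_drop !nth_drop sz_w.
  have -> : (m + (i - m.+1) = i.-1)%N by lia.
  have -> : (m + (i - m.+1).+1 = i)%N by lia.
  by move=> -> //; lia.
pose desc i := w`_i < w`_i.-1.
case: (boolP (has desc (index_iota m.+1 n))) => [/hasP[i]|].
  by rewrite /desc => i_mn lt_i; rewrite (big_rem i) //= lt_i mul0r.
rewrite -all_predC => /allP sw; case: nsw => i.
rewrite size_drop !nth_drop sz_w => lt_i.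
have := sw (m + i.+1)%N; rewrite mem_index_iota addnS /= /desc -leNgt.
by apply; lia.
Qed.

End LastBlock.

(** * The words without type D descent *)

Section Minimal.
Implicit Types (A : seq nat) (w : seq int).

(** No type D descent, that is, |w_1| < w_2 < ... < w_n if the absolute values
differ. *)
Definition D_sorted w := ~~ (w`_1 < - w`_0) && sorted <=%R w.
Definition pos_sorted w := all (fun x => 0 <= x) w && sorted <=%R w.

(** The words without type D descent are this one and the one obtained by
flipping the sign of its first letter; see [D_sorted_pos_sorted]. *)
Lemma filter_pos_sorted A : 0%N \notin A ->
  [seq w <- swords A | pos_sorted w] = [:: map Posz (sort leq A)].
Proof.
move=> A0; have absK (p : seq nat) : map absz (map Posz p) = p.
  by rewrite -map_comp (eq_map (g := id)) ?map_id.
apply: perm_small_eq => //; apply: uniq_perm => // [|w].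
  by rewrite filter_uniq ?swords_uniq.
rewrite mem_filter inE mem_swords; apply/andP/eqP => [[/andP[w_ge0 sw] w_A]|->].
  have wE : w = map Posz (map absz w).
    rewrite -map_comp -[LHS]map_id; apply/eq_in_map => x /(allP w_ge0) /=.
    by move=> x_ge0; rewrite gez0_abs.
  rewrite wE; congr map.
  have s_abs : sorted leq (map absz w) by rewrite wE sorted_map in sw.
  rewrite -(sorted_sort leq_trans s_abs); apply/perm_sortP => //.
  - exact: leq_total.
  - exact: leq_trans.
  - exact: anti_leq.
split; last by rewrite absK perm_sort.
rewrite /pos_sorted all_map sorted_map (sort_sorted leq_total) andbT.
by apply/allP.
Qed.

Lemma invS_ge0 w : all (fun x => 0 <= x) w -> invS w = 0%N.
Proof.
elim: w => //= x w IHw /andP[x_ge0 w_ge0]; rewrite IHw // addn0.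
apply/eqP; rewrite eqn0Ngt -has_count -all_predC.
by apply: sub_all w_ge0 => y /=; lia.
Qed.

Lemma D_sorted_cons (x y : int) w : D_sorted (x :: y :: w) ->
  all (fun z => `|x| <= z) (y :: w) /\ sorted <=%R (y :: w).
Proof.
rewrite /D_sorted /= -leNgt => /and3P[Nxy xy yw]; split=> //.
have xy' : `|x| <= y by lia.
rewrite xy' /=; apply: sub_all (order_path_min le_trans yw) => z /=.
exact: le_trans.
Qed.

Lemma D_sorted_invw w : (1 < size w)%N -> D_sorted w -> invw w = 0%N.
Proof.
case: w => [|x [|y w]] // _ min_w; have [w_x _] := D_sorted_cons min_w.
rewrite /invw sorted_invA ?(andP min_w).2 // /invS -/invS.
rewrite -/(invS (y :: w)) invS_ge0 ?addn0 ?add0n; last first.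
  by apply: sub_all w_x => z /=; lia.
apply/eqP; rewrite eqn0Ngt -has_count -all_predC.
by apply: sub_all w_x => z /=; lia.
Qed.

Lemma D_sorted_pos_sorted (a : nat) w : (0 < size w)%N ->
  D_sorted (a%:Z :: w) = pos_sorted (a%:Z :: w) /\
  D_sorted (- a%:Z :: w) = pos_sorted (a%:Z :: w).
Proof.
case: w => // y w _.
have -> : pos_sorted (a%:Z :: y :: w) = (a%:Z <= y) && path <=%R y w.
  rewrite /pos_sorted /=; case ay: (a%:Z <= y); last by rewrite andbF.
  case yw: (path _ _ _); last by rewrite !andbF.
  rewrite !andbT; apply/andP; split; first by lia.
  by apply: sub_all (order_path_min le_trans yw) => z /=; lia.
rewrite /D_sorted /= -!leNgt opprK !andbA.
by split; congr (_ && _); lia.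
Qed.

(** Two words remain, and neither has an inversion. *)
Lemma sum_D_sorted (K : fieldType) (q : K) A :
    uniq A -> 0%N \notin A -> (1 < size A)%N ->
  \sum_(w <- swords A) (D_sorted w)%:R * q ^+ invw w = 2.
Proof.
move=> uA A0 A_gt1; have A_gt0 := ltnW A_gt1.
transitivity (\sum_(w <- swords A) (D_sorted w)%:R : K).
  apply: eq_big_seq => w /swords_size sz_w; have [min_w|] := boolP (D_sorted w).
    by rewrite D_sorted_invw ?sz_w // mulr1.
  by rewrite mul0r.
transitivity (2 * \sum_(w <- swords A) (pos_sorted w)%:R : K); last first.
  have -> : \sum_(w <- swords A) (pos_sorted w)%:R =
      (size [seq w <- swords A | pos_sorted w])%:R :> K.
    rewrite size_filter -sum1_count [in RHS]big_mkcond natr_sum.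
    by apply: eq_bigr => w _; case: pos_sorted.
  by rewrite filter_pos_sorted // mulr1.
rewrite !sum_swords_front // mulr_sumr; apply: eq_big_seq => a a_A.
rewrite mulr_sumr; apply: eq_big_seq => w /swords_size sz_w.
have w_gt0 : (0 < size w)%N by rewrite sz_w size_rem // ltn_predRL.
have [-> ->] := D_sorted_pos_sorted a w_gt0.
have /negPf -> : ~~ pos_sorted (- a%:Z :: w).
  have : a != 0%N by apply: contraNneq A0 => <-.
  by rewrite /pos_sorted /=; lia.
by rewrite addr0 mulrDl mul1r.
Qed.

End Minimal.

(** * The recurrence for the descent sums *)

Section Recurrence.
Variables (K : fieldType) (q : K) (c : nat -> K).
Implicit Types (A : seq nat) (w : seq int).

Definition descent_sum n : K :=
  \sum_(w <- swords (iota 1 n)) descent_weight c n w * q ^+ invw w.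

Definition asc_prod m n : K := \prod_(m <= i < n) (1 - c i).

Lemma descent_weight_take m w : (1 < m)%N ->
  descent_weight c m (take m w) = descent_weight c m w.
Proof.
move=> m_gt1; rewrite /descent_weight /wt_head /wt_step.
rewrite !nth_take ?(ltnW m_gt1) //.
congr (_ * _); apply: eq_big_nat => i /andP[i_gt0 lt_im].
by rewrite !nth_take // (leq_ltn_trans (leq_pred i)).
Qed.

Lemma prod_asc m n w : size w = n ->
  \prod_(m.+1 <= i < n) ((1 - c i) * (~~ (w`_i < w`_i.-1))%:R) =
  asc_prod m.+1 n * (sorted <=%R (drop m w))%:R.
Proof. by move=> sz_w; rewrite big_split /= (prod_sorted_drop K m sz_w). Qed.

(** The five summands are, in this order: all ascents, all ascents but the one
at -1, all but the one at 1, all but these two, and a block starting at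
m + 1 > 2.  In the third, a word with ascents at -1, 2, ..., n - 1 becomes
increasing once the sign of its first letter is flipped. *)
Lemma descent_weight_expand n w : (1 < n)%N -> size w = n ->
  descent_weight c n w =
    (1 - c 0%N) * asc_prod 1 n * (D_sorted w)%:R
  + c 0%N * asc_prod 1 n * (sorted <=%R (drop 0 w))%:R
  + (1 - c 0%N) * c 1%N * asc_prod 2 n
      * (sorted <=%R (drop 0 (flip_head w)))%:R
  + c 0%N * c 1%N * asc_prod 2 n * (sorted <=%R (drop 1 w))%:R
  + \sum_(2 <= m < n) c m * asc_prod m.+1 n
      * ((sorted <=%R (drop m w))%:R * descent_weight c m (take m w)).
Proof.
move=> n_gt1 sz_w; have n_gt0 := ltnW n_gt1.
have y_expand i : wt_step c w i = c i + (1 - c i) * (~~ (w`_i < w`_i.-1))%:R.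
  by rewrite /wt_step; case: ifP => _ /=; ring.
have h_expand : wt_head c w = c 0%N + (1 - c 0%N) * (~~ (w`_1 < - w`_0))%:R.
  by rewrite /wt_head; case: ifP => _ /=; ring.
rewrite {1}/descent_weight (prod_last_block y_expand) //.
rewrite [\sum_(1 <= m < n) _]big_ltn //.
rewrite (big_geq (leqnn 1)) mul1r !mulrDr !prod_asc // drop0.
have -> : \sum_(2 <= m < n) c m * asc_prod m.+1 n
      * ((sorted <=%R (drop m w))%:R * descent_weight c m (take m w)) =
   wt_head c w * \sum_(2 <= m < n) \prod_(1 <= i < m) wt_step c w i * c m *
     \prod_(m.+1 <= i < n) ((1 - c i) * (~~ (w`_i < w`_i.-1))%:R).
  rewrite mulr_sumr; apply: eq_big_nat => m /andP[m_gt1 _].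
  by rewrite descent_weight_take // prod_asc // /descent_weight; ring.
rewrite addrA; congr (_ + _).
have -> : D_sorted w = ~~ (w`_1 < - w`_0) && sorted <=%R w by [].
have -> : sorted <=%R (drop 0 (flip_head w)) =
    ~~ (w`_1 < - w`_0) && sorted <=%R (drop 1 w).
  rewrite drop0; move: sz_w n_gt1.
  case: w {h_expand y_expand} => [|x [|y w]] /= <- // _.
  by rewrite -leNgt.
rewrite h_expand -!mulnb !natrM; ring.
Qed.

Hypothesis qfact_neq0 : forall n, qfact n q != 0.
Hypothesis Bfact_neq0 : forall n, Bfact q n != 0.

(** [sum_sorted_drop_take] in the form in which the recurrence uses it. *)
Lemma sum_sorted_factor m A (g : seq int -> K) :
    uniq A -> 0%N \notin A -> (m <= size A)%N ->
  \sum_(w <- swords A)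
     (sorted <=%R (drop m w))%:R * g (take m w) * q ^+ invw w =
  (\sum_(w <- swords A) g (take m w) * q ^+ invw w) / qfact (size A - m) q.
Proof.
move=> uA A0 le_mA; rewrite -(sum_sorted_drop_take q g uA A0 le_mA).
by rewrite mulrC mulKf.
Qed.

Lemma sum_sorted_const m A : uniq A -> 0%N \notin A -> (m <= size A)%N ->
  \sum_(w <- swords A) (sorted <=%R (drop m w))%:R * q ^+ invw w =
  Bfact q (size A) / qfact (size A - m) q.
Proof.
move=> uA A0 le_mA; have := sum_sorted_factor (fun=> 1) uA A0 le_mA.
under eq_bigr do rewrite mulr1.
by under [X in X / _]eq_bigr do rewrite mul1r; rewrite sum_invw.
Qed.

Lemma flip_headK : involutive flip_head.
Proof. by case=> //= x w; rewrite opprK. Qed.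

(** The two ways in which the first letter enters an inversion are exchanged. *)
Lemma invw_flip w : invw (flip_head w) = invw w.
Proof.
case: w => //= x w; rewrite /invw /= opprK addnACA.
by rewrite [(count _ _ + count _ _)%N]addnC addnACA.
Qed.

(** The terms of [descent_weight_expand] summed over all words; the second and
third summands there have the same sum up to their coefficients. *)
Definition descent_sum_rec n : K :=
    2 * ((1 - c 0%N) * asc_prod 1 n)
  + (c 0%N * asc_prod 1 n + (1 - c 0%N) * c 1%N * asc_prod 2 n)
      * (Bfact q n / qfact n q)
  + c 0%N * c 1%N * asc_prod 2 n * (Bfact q n / qfact n.-1 q)
  + \sum_(2 <= m < n) c m * asc_prod m.+1 n
      * (descent_sum m * Bfact q n / Bfact q m / qfact (n - m) q).

(** The induction is on the size of the alphabet: that the sum for shorter words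
does not depend on the alphabet is what [sum_prefix] requires, and it follows
from the recurrence itself. *)
Lemma sum_descent_weight A : uniq A -> 0%N \notin A -> (1 < size A)%N ->
  \sum_(w <- swords A) descent_weight c (size A) w * q ^+ invw w =
  descent_sum_rec (size A).
Proof.
have [n] := ubnP (size A); elim: n A => // n IHn A le_An uA A0 A_gt1.
have descent_sumE m B : (1 < m < size A)%N ->
    uniq B -> 0%N \notin B -> size B = m ->
    \sum_(w <- swords B) descent_weight c m w * q ^+ invw w = descent_sum m.
  move=> /andP[m_gt1 lt_mA] uB B0 sizeB; have lt_mn := leq_trans lt_mA le_An.
  rewrite -sizeB IHn ?sizeB // /descent_sum.
  have := IHn (iota 1 m); rewrite size_iota => -> //; first exact: iota_uniq.
  by rewrite mem_iota.
under eq_big_seq => w /swords_size sz_w do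
  rewrite (descent_weight_expand A_gt1) // ![(_ + _) * q ^+ _]mulrDl.
rewrite !big_split /= /descent_sum_rec; congr (_ + _ ); last first.
  under eq_bigr do rewrite mulr_suml.
  rewrite exchange_big; apply: eq_big_nat => m /andP[m_gt1 lt_mA].
  under eq_bigr do rewrite -[_ * q ^+ _]mulrA.
  rewrite -mulr_sumr sum_sorted_factor ?(ltnW lt_mA) //; congr (_ * (_ / _)).
  apply: (@sum_prefix_ratio _ q m (descent_weight c m)) => //; last exact: ltnW.
  by move=> B; apply: descent_sumE; rewrite m_gt1.
congr (_ + _); last first.
  under eq_bigr do rewrite -[_ * q ^+ _]mulrA.
  by rewrite -mulr_sumr sum_sorted_const ?(ltnW A_gt1) // subn1.
rewrite [(_ + _) * (_ / _)]mulrDl addrA; congr (_ + _); last first.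
  (* Both the condition and [invw] are evaluated at the flipped word. *)
  rewrite sum_swords_flip //.
  transitivity (\sum_(w <- swords A) (1 - c 0%N) * c 1%N * asc_prod 2 (size A) *
     ((sorted <=%R (drop 0 w))%:R * q ^+ invw w)).
    by apply: eq_bigr => w _; rewrite invw_flip flip_headK mulrA.
  by rewrite -mulr_sumr sum_sorted_const // subn0.
congr (_ + _); last first.
  under eq_bigr do rewrite -[_ * q ^+ _]mulrA.
  by rewrite -mulr_sumr sum_sorted_const // subn0.
under eq_bigr do rewrite -[_ * q ^+ _]mulrA.
by rewrite -mulr_sumr sum_D_sorted // mulrC.
Qed.

Lemma descent_sum_recurrence n : (1 < n)%N -> descent_sum n = descent_sum_rec n.
Proof.
move=> n_gt1; have := @sum_descent_weight (iota 1 n).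
rewrite size_iota; apply=> //.
  exact: iota_uniq.
by rewrite mem_iota.
Qed.

End Recurrence.

(** * Signed permutations as words *)

Section Words.
Variable n : nat.
Implicit Types (w : {perm letter n}) (x : seq int).

Definition word w : seq int := mkseq (fun i => entry w i.+1) n.

Lemma entryE w (i : 'I_n) : entry w i.+1 = letter_val (w (i, false)).
Proof. by rewrite /entry /= valK. Qed.

Lemma nth_word w i : (word w)`_i = entry w i.+1.
Proof.
have [lt_in|le_ni] := ltnP i n; first by rewrite nth_mkseq.
by rewrite nth_default ?size_mkseq // /entry insubN //= -leqNgt.
Qed.

Lemma size_word w : size (word w) = n.
Proof. exact: size_mkseq. Qed.

Lemma letter_val_inj : injective (@letter_val n).
Proof.
move=> [i b] [j d]; rewrite /letter_val /=.
by case: b; case: d => /eqP; rewrite ?eqr_opp ?eqr_oppLR => /eqP eq_ij //;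
  do ?[by lia]; congr (_, _); apply: val_inj => /=; lia.
Qed.

Lemma absz_letter_val (y : letter n) : absz (letter_val y) = y.1.+1.
Proof. by rewrite /letter_val; case: y.2; rewrite ?abszN. Qed.

Lemma BgroupP w : reflect (forall y, w (letter_opp y) = letter_opp (w y))
  (w \in Bgroup n).
Proof. by rewrite inE; apply: (iffP forallP) => wP y; apply/eqP. Qed.

Lemma word_swords w : w \in Bgroup n -> word w \in swords (iota 1 n).
Proof.
move=> /BgroupP wB; rewrite mem_swords.
have wE : map absz (word w) = [seq (w (i, false)).1.+1 | i <- enum 'I_n].
  rewrite -map_comp -val_enum_ord -map_comp; apply: eq_map => i /=.
  by rewrite entryE absz_letter_val.
have uw : uniq (map absz (word w)).
  rewrite wE map_inj_uniq ?enum_uniq // => i j [/val_inj eq_ij].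
  have [] : w (i, false) = w (j, false) \/ w (i, false) = w (j, true).
  - rewrite (wB (j, false)) /letter_opp.
    case: (w (i, false)) (w (j, false)) eq_ij => [k b] [l d] /= ->.
    by case: b; case: d; by [left | right].
  - by move/perm_inj => [].
  - by move/perm_inj.
have [] := @uniq_min_size _ (map absz (word w)) (iota 1 n) uw.
- move=> k; rewrite wE => /mapP[i _ ->].
  by rewrite mem_iota add1n !ltnS leq0n ltn_ord.
- by rewrite size_map size_word size_iota.
by move=> _ eq_w; apply: uniq_perm => //; apply: iota_uniq.
Qed.

Lemma word_inj : {in Bgroup n &, injective word}.
Proof.
move=> w w' /BgroupP wB /BgroupP w'B eq_w.
have eq_pos i : w (i, false) = w' (i, false).
  by apply: letter_val_inj; rewrite -!entryE -!nth_word eq_w.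
apply/permP => -[i []]; last exact: eq_pos.
by rewrite (wB (i, false)) (w'B (i, false)) eq_pos.
Qed.

End Words.

(** The permutation read off from a word sends the letter i to the i-th entry,
and is extended to negative letters by oddness. *)
Lemma word_surj n x : x \in swords (iota 1 n) ->
  exists2 w, w \in Bgroup n & x = word w.
Proof.
rewrite mem_swords => x_perm.
have sz_x : size x = n by rewrite -(size_map absz) (perm_size x_perm) size_iota.
case: n => [|n] in x_perm sz_x *.
  exists 1%g; last by rewrite (size0nil sz_x).
  by apply/BgroupP => -[[]].
have abs_x (i : 'I_n.+1) : (0 < absz (x`_i)%R <= n.+1)%N.
  have : absz x`_i \in iota 1 n.+1.
    by rewrite -(perm_mem x_perm) map_f // mem_nth // sz_x.
  by rewrite mem_iota.
have abs_lt (i : 'I_n.+1) : ((absz (x`_i)%R).-1 < n.+1)%N.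
  by have /andP[xi le_xi] := abs_x i; rewrite prednK.
have abs_inj (i j : 'I_n.+1) : absz x`_i = absz x`_j -> i = j.
  rewrite -!(nth_map 0 0%N absz) ?sz_x // => /eqP.
  rewrite nth_uniq ?size_map ?sz_x // ?(perm_uniq x_perm) ?iota_uniq //.
  by move/eqP/val_inj.
pose f (y : letter n.+1) : letter n.+1 :=
  (inord (absz x`_y.1).-1, (x`_y.1 < 0) (+) y.2).
have f_inj : injective f.
  move=> [i b] [j d] [/(congr1 val)]; rewrite /= !inordK //.
  move=> eq_ij eq_b; have ij : i = j.
    have /andP[xi _] := abs_x i; have /andP[xj _] := abs_x j.
    by apply: abs_inj; rewrite -(prednK xi) eq_ij prednK.
  by move: eq_b; rewrite ij => /addbI->.
exists (perm f_inj).
  by apply/BgroupP => y; rewrite !permE /f /letter_opp /= addbN.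
apply: (@eq_from_nth _ 0) => [|i]; rewrite ?size_word ?sz_x // => lt_in.
rewrite nth_word (entryE _ (Ordinal lt_in)) permE /f /letter_val /= addbF.
have /andP[xi _] := abs_x (Ordinal lt_in).
rewrite inordK ?(abs_lt (Ordinal lt_in)) // prednK //=.
by case: ifP => /=; lia.
Qed.

(** * Flipping the sign of the letter of absolute value 1 *)

Section FlipOne.
Implicit Types (A : seq nat) (x : seq int).

Definition flip_letter (y : int) : int := if absz y == 1%N then - y else y.
Definition flip_one x := map flip_letter x.

Lemma flip_letterK : involutive flip_letter.
Proof.
move=> y; rewrite /flip_letter; case ay: (absz y == 1%N); last by rewrite ay.
by rewrite abszN ay opprK.
Qed.

Lemma flip_oneK : involutive flip_one.
Proof. exact: mapK flip_letterK. Qed.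

Lemma flip_one_swords A x : (flip_one x \in swords A) = (x \in swords A).
Proof.
rewrite !mem_swords -map_comp; congr (perm_eq _ A); apply: eq_map => y.
by rewrite /= /flip_letter; case: ifP; rewrite ?abszN.
Qed.

(** The sign of the number of larger absolute value decides the comparison. *)
Lemma flip_letter_lt (y z : int) : y != 0 -> z != 0 -> absz y != absz z ->
  (flip_letter y < flip_letter z) = (y < z).
Proof. by rewrite /flip_letter; do 2?case: ifP; lia. Qed.

Lemma flip_letter_ltN (y z : int) : y != 0 -> z != 0 -> absz y != absz z ->
  (flip_letter y < - flip_letter z) = (y < - z).
Proof. by rewrite /flip_letter; do 2?case: ifP; lia. Qed.

Lemma odd_neg_flip x :
  odd (count (< 0) (flip_one x)) =
  odd (count (< 0) x) (+) odd (count_mem 1%N (map absz x)).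
Proof.
elim: x => //= y x IHx; rewrite !oddD IHx addbACA; congr (_ (+) _).
by rewrite /flip_letter; case: ifP; lia.
Qed.

Lemma nth_flip_one x i : (flip_one x)`_i = flip_letter x`_i.
Proof.
have [lt_ix|le_xi] := ltnP i (size x); first exact: nth_map.
by rewrite !nth_default ?size_map.
Qed.

Lemma invw_flip_one x : uniq (map absz x) -> 0 \notin x ->
  invw (flip_one x) = invw x.
Proof.
move=> ux x0.
suff [eqA eqS] : invA (flip_one x) = invA x /\ invS (flip_one x) = invS x.
  by rewrite /invw eqA eqS.
elim: x ux x0 => //= y x IHx /andP[yx ux].
rewrite inE negb_or => /andP[y_neq0 x0]; have [-> ->] := IHx ux x0.
have abs_yx z : z \in x -> absz z != absz y.
  by move=> z_x; apply: contraNneq yx => <-; apply: map_f.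
rewrite !count_map; split; congr (_ + _)%N; apply: eq_in_count => z z_x /=;
  have z0 : z != 0 by apply: contraNneq x0 => <-.
  by rewrite flip_letter_lt ?abs_yx // eq_sym.
by rewrite flip_letter_ltN ?abs_yx // eq_sym.
Qed.

Lemma descent_weight_flip_one (K : fieldType) (c : nat -> K) x :
    uniq (map absz x) -> 0 \notin x -> (1 < size x)%N ->
  descent_weight c (size x) (flip_one x) = descent_weight c (size x) x.
Proof.
move=> ux x0 x_gt1.
have nth_neq0 i : (i < size x)%N -> x`_i != 0.
  by move=> lt_i; apply: contraNneq x0 => <-; apply: mem_nth.
have abs_neq i j : (i < size x)%N -> (j < size x)%N -> i != j ->
    absz x`_i != absz x`_j.
  move=> lt_i lt_j; rewrite -!(nth_map 0 0%N absz) //.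
  by rewrite nth_uniq ?size_map.
rewrite /descent_weight /wt_head /wt_step !nth_flip_one.
rewrite flip_letter_ltN ?abs_neq ?nth_neq0 ?(ltnW x_gt1) //; congr (_ * _).
apply: eq_big_nat => i /andP[i_gt0 lt_i]; rewrite !nth_flip_one.
have lt_i' := leq_ltn_trans (leq_pred i) lt_i.
rewrite flip_letter_lt ?nth_neq0 // abs_neq //.
by case: i i_gt0 {lt_i lt_i'} => //= i _; rewrite neq_ltn ltnSn orbT.
Qed.

End FlipOne.

(** * Sums over even-signed permutations *)

Section DSums.
Variables (K : fieldType) (n : nat).
Hypothesis n_gt0 : (0 < n)%N.

Let iota0 : 0%N \notin iota 1 n. Proof. by rewrite mem_iota. Qed.

Lemma mem_Dgroup (w : {perm letter n}) :
  (w \in Dgroup n) = (w \in Bgroup n) && ~~ odd (count (< 0) (word w)).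
Proof.
rewrite inE; congr (_ && ~~ odd _).
rewrite cardsE cardE /enum_mem size_filter count_map -val_enum_ord count_map.
rewrite enumT.
by apply: eq_count => i /=; rewrite unfold_in.
Qed.

(** Flipping the letter ±1 is an involution of the signed words that changes the
parity of the number of negative letters and preserves [F]. *)
Lemma sum_Dgroup (F : seq int -> K) :
    (forall x, x \in swords (iota 1 n) -> F (flip_one x) = F x) ->
  2 * \sum_(w in Dgroup n) F (word w) = \sum_(x <- swords (iota 1 n)) F x.
Proof.
move=> F_flip; pose ev x := ~~ odd (count (fun y : int => y < 0) x).
have -> : \sum_(w in Dgroup n) F (word w) =
    \sum_(x <- swords (iota 1 n) | ev x) F x.
  have /(perm_big _) -> /= :
      perm_eq (swords (iota 1 n)) (map (@word n) (enum (Bgroup n))).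
    apply: uniq_perm => [||x]; first by rewrite swords_uniq.
      rewrite map_inj_in_uniq ?enum_uniq // => w w'; rewrite !mem_enum.
      exact: word_inj.
    apply/idP/mapP => [/word_surj[w wB ->]|[w]].
      by exists w; rewrite ?mem_enum.
    by rewrite mem_enum => wB ->; apply: word_swords.
  rewrite big_map big_enum_cond /=; apply: eq_bigl => w.
  by rewrite mem_Dgroup.
rewrite mulrDl mul1r [RHS](bigID ev) /=; congr (_ + _).
have eq_flip : perm_eq (swords (iota 1 n)) (map flip_one (swords (iota 1 n))).
  apply: uniq_perm => [||x]; first by rewrite swords_uniq.
    by rewrite (map_inj_uniq (can_inj flip_oneK)) swords_uniq.
  by rewrite -[x in RHS]flip_oneK (mem_map (can_inj flip_oneK)) flip_one_swords.
rewrite (perm_big _ eq_flip) big_map big_seq_cond [RHS]big_seq_cond.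
apply: eq_big => [x|x /andP[/F_flip]] //.
case x_n: (x \in _) => //=; rewrite /ev odd_neg_flip.
rewrite mem_swords in x_n; rewrite (seq.permP x_n) count_uniq_mem ?iota_uniq //.
by rewrite mem_iota /= add1n ltnS n_gt0 addbT.
Qed.

End DSums.

(** Index 0 stands for the descent -1, which is odd. *)
Definition Dweight (K : fieldType) (s t : K) (i : nat) : K :=
  if (i == 0%N) || odd i then t else s.

Section Statistics.
Variables (n : nat).
Implicit Types (w : {perm letter n}).

(** Both halves of the type D inversion number are computed by such a recursion,
and are sets of pairs of positions in their definition by permutations. *)
Lemma card_pairs (P : rel int) (g : seq int -> nat) :
    g [::] = 0%N -> (forall y x, g (y :: x) = (count (P y) x + g x)%N) ->
  forall x, #|[set ij : 'I_(size x) * 'I_(size x) |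
      (ij.1 < ij.2)%N && P x`_ij.1 x`_ij.2]| = g x.
Proof.
move=> g0 gS x; rewrite -sum1_card; under eq_bigl do rewrite inE.
rewrite big_mkcond -(pair_bigA _ (fun i j : 'I_(size x) =>
  if (i < j)%N && P x`_i x`_j then 1%N else 0%N)) /=.
elim: x => [|y x IHx]; first by rewrite big_ord0.
rewrite gS -IHx /= big_ord_recl /= big_ord_recl /= add0n; congr (_ + _)%N.
  rewrite -sum1_count [RHS]big_mkcond (big_nth 0) big_mkord.
  by apply: eq_bigr => i _.
by apply: eq_bigr => i _; rewrite big_ord_recl.
Qed.

Lemma invD_word w : invD w = invw (word w).
Proof.
rewrite /invw -(card_pairs (P := fun y z => z < y) (g := invA)) //.
rewrite -(card_pairs (P := fun y z => z < - y) (g := invS)) //.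
rewrite size_word; congr (_ + _)%N; apply: eq_card => ij;
  by rewrite !inE !nth_word.
Qed.

Lemma weight_word (K : fieldType) (s t : K) w : (0 < n)%N ->
  s ^+ edesD w * t ^+ odesD w =
  descent_weight (Dweight s t) n (word w).
Proof.
move=> n_gt0; pose c (i : int) := if odd (absz i) then t else s.
transitivity (\prod_(i <- desD w) c i).
  rewrite /edesD /odesD; elim: (desD w) => [|i d IHd].
    by rewrite big_nil mulr1.
  rewrite big_cons -IHd /= /c; case: odd; rewrite /= ?add0n ?add1n exprS; ring.
rewrite /desD big_filter big_mkcond big_cons big_map /descent_weight /wt_head.
rewrite !nth_word; congr (_ * _); rewrite /index_iota subn1.
apply: eq_big_seq => i; rewrite mem_iota => /andP[i_gt0 _].
rewrite /wt_step !nth_word prednK // /c /entryD /=.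
by case: i i_gt0.
Qed.

End Statistics.

Section Counts.
Variables (K : fieldType) (q : K).

Lemma uniq_absz_swords n x : x \in swords (iota 1 n) -> uniq (map absz x).
Proof. by rewrite mem_swords => /perm_uniq ->; apply: iota_uniq. Qed.

Lemma neq0_swords n x : x \in swords (iota 1 n) -> 0 \notin x.
Proof.
rewrite mem_swords => x_perm; apply/negP => /(map_f absz).
by rewrite (perm_mem x_perm) mem_iota.
Qed.

Lemma Dpoly1_Bfact n : (0 < n)%N -> 2 * Dpoly1 n q = Bfact q n.
Proof.
move=> n_gt0; rewrite /Dpoly1; under eq_bigr do rewrite invD_word.
rewrite (sum_Dgroup n_gt0 (F := fun x => q ^+ invw x)) => [|x x_n].
  by rewrite sum_invw ?size_iota ?iota_uniq // mem_iota.
by rewrite invw_flip_one ?(uniq_absz_swords x_n) ?(neq0_swords x_n).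
Qed.

(** Without letters, signed and even-signed permutations coincide, so the factor
2 of the previous lemma is absent. *)
Lemma Dpoly1_0 : Dpoly1 0 q = 1.
Proof.
have perm1 (w : {perm letter 0}) : w = 1%g by apply/permP => -[[]].
rewrite /Dpoly1 (big_pred1 1%g) => [|w]; first by rewrite invD_word expr0.
rewrite /= mem_Dgroup (perm1 w) eqxx /= andbT.
by apply/BgroupP => -[[]].
Qed.

Lemma Dpoly_descent_sum s t n : (1 < n)%N ->
  2 * Dpoly n s t q = descent_sum q (Dweight s t) n.
Proof.
move=> n_gt1; have n_gt0 := ltnW n_gt1.
rewrite /Dpoly /descent_sum; set c := Dweight s t.
under eq_bigr do rewrite invD_word weight_word // -/c.
pose F x := descent_weight c n x * q ^+ invw x.
rewrite (sum_Dgroup n_gt0 (F := F)) // => x x_n; rewrite {}/F.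
have ux := uniq_absz_swords x_n; have x0 := neq0_swords x_n.
have sz_x := swords_size x_n.
rewrite size_iota in sz_x; rewrite invw_flip_one //.
by have := @descent_weight_flip_one _ c x ux x0; rewrite sz_x => ->.
Qed.

End Counts.

(** * Coefficients of power series *)

Section Coefficients.
Variable K : fieldType.
Implicit Types (f g : fps K) (a b : K).

Lemma fcoefD f g n : fcoef (f + g) n = fcoef f n + fcoef g n.
Proof. by []. Qed.

Lemma fcoefB f g n : fcoef (f - g) n = fcoef f n - fcoef g n.
Proof. by []. Qed.

Lemma fcoefM f g n :
  fcoef (f * g) n = \sum_(i < n.+1) fcoef f i * fcoef g (n - i).
Proof. by []. Qed.

Lemma fcoef1 n : fcoef (1 : fps K) n = (n == 0%N)%:R.
Proof. by rewrite /=; case: eqP. Qed.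

Lemma fcoefX n : fcoef (fpsX K) n = (n == 1%N)%:R.
Proof. by []. Qed.

Lemma fcoef_dil a f n : fcoef (fps_dil a f) n = a ^+ n * fcoef f n.
Proof. by []. Qed.

Lemma fcoefCM a f n : fcoef (fpsC a * f) n = a * fcoef f n.
Proof.
rewrite fcoefM big_ord_recl /= subn0 big1 ?addr0 // => i _.
by rewrite mul0r.
Qed.

Lemma fcoefXM f n : fcoef (fpsX K * f) n.+1 = fcoef f n.
Proof.
rewrite fcoefM big_ord_recl /= mul0r add0r big_ord_recl /= mul1r subn1 /=.
by rewrite big1 ?addr0 // => i _; rewrite mul0r.
Qed.

Lemma fcoefXM0 f : fcoef (fpsX K * f) 0 = 0.
Proof. by rewrite fcoefM big_ord1 mul0r. Qed.

Lemma fpsCD a b : fpsC (a + b) = fpsC a + fpsC b.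
Proof. by apply/fpsP => n; rewrite fcoefD /=; case: ifP; rewrite ?addr0. Qed.

Lemma fpsC1 : fpsC 1 = 1 :> fps K.
Proof. by []. Qed.

Lemma fpsCB a b : fpsC (a - b) = fpsC a - fpsC b.
Proof. by apply/fpsP => n; rewrite fcoefB /=; case: ifP; rewrite ?subr0. Qed.

Lemma fpsCM a b : fpsC (a * b) = fpsC a * fpsC b.
Proof.
by apply/fpsP => n; rewrite fcoefCM /=; case: ifP; rewrite ?mulr0.
Qed.

(** Here 2 is a power series, and its inverse has to be related to that of the
scalar 2. *)
Lemma fcoef_half f n : 2 != 0 :> K -> fcoef (f / 2) n = fcoef f n / 2.
Proof.
move=> two_neq0; have two_unit : (2 : fps K) \is a GRing.unit.
  by rewrite unfold_in /= /fps_unit fcoefD !fcoef1.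
apply: (canRL (mulfK two_neq0)); rewrite mulrDr !mulr1 -fcoefD.
by rewrite -[X in X + _]mulr1 -[X in _ + X]mulr1 -mulrDr divrK.
Qed.

Lemma fps_eq_div f g h : fcoef h 0 != 0 -> f * h = g -> f = g / h.
Proof. by move=> h0 <-; rewrite mulrK. Qed.

End Coefficients.

(** * The functional equations of the generating functions *)

Section GeneratingFunctions.
Variables (K : fieldType) (s t q M : K).
Hypothesis two_neq0 : 2 != 0 :> K.
Hypothesis qfact_neq0 : forall n, qfact n q != 0.
Hypothesis Bfact_neq0 : forall n, Bfact q n != 0.
Hypothesis s_neq1 : 1 - s != 0.
Hypothesis t_neq1 : 1 - t != 0.
Hypothesis M_sq : M ^+ 2 = (1 - s) * (1 - t).

Let M_neq0 : M != 0.
Proof.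
apply: contra_eq_neq M_sq => ->.
by rewrite expr0n eq_sym mulf_neq0.
Qed.

Lemma Dpoly1_neq0 n : Dpoly1 n q != 0.
Proof.
case: n => [|n]; first by rewrite Dpoly1_0 oner_neq0.
have := Bfact_neq0 n.+1.
by rewrite -Dpoly1_Bfact // mulf_eq0 negb_or => /andP[].
Qed.

Lemma Dpoly1_1 : Dpoly1 1 q = 1.
Proof.
apply: (mulfI two_neq0); rewrite Dpoly1_Bfact // /Bfact big_nat1 /Bfactor.
by rewrite /qint big_ord1 expr0.
Qed.

Lemma qfact1 : qfact 1 q = 1.
Proof. by rewrite /qfact big_nat1 /qint big_ord1 expr0. Qed.

Notation ratio n := (Dpoly n s t q / Dpoly1 n q).
Notation c := (Dweight s t).

(** The factor 2 between signed and even-signed permutations disappears from the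
ratios, and leaves 1 / D_n(1,q) as the weight of the words without descent. *)
Lemma ratio_recurrence n : (1 < n)%N ->
  ratio n =
    asc_prod c 2 n * ((1 - t) ^+ 2 / Dpoly1 n q + 2 * t * (1 - t) / qfact n q
                      + t ^+ 2 / qfact n.-1 q)
  + \sum_(2 <= m < n) c m * asc_prod c m.+1 n * ratio m / qfact (n - m) q.
Proof.
move=> n_gt1; have n_gt0 := ltnW n_gt1.
have D_neq0 := Dpoly1_neq0 n.
have qn := qfact_neq0 n; have qn1 := qfact_neq0 n.-1.
have BE m : (0 < m)%N -> Bfact q m = 2 * Dpoly1 m q.
  by move=> m_gt0; rewrite Dpoly1_Bfact.
apply: (mulIf (Bfact_neq0 n)); rewrite {1}BE // mulrCA divfK //.
rewrite Dpoly_descent_sum // descent_sum_recurrence // /descent_sum_rec.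
have -> : asc_prod c 1 n = (1 - t) * asc_prod c 2 n.
  by rewrite /asc_prod big_ltn.
rewrite [RHS]mulrDl; congr (_ + _).
  rewrite BE // /Dweight /=; field; do ?[apply/andP; split] => //.
rewrite mulr_suml; apply: eq_big_nat => m /andP[m_gt1 lt_mn].
rewrite -Dpoly_descent_sum // [Bfact q m]BE ?(ltnW m_gt1) //.
field; do ?[apply/andP; split] => //; exact: Dpoly1_neq0.
Qed.

Lemma cosh_coef n :
  fcoef (fps_dil M (cosh_q q)) n = (~~ odd n)%:R * M ^+ n / qfact n q.
Proof.
rewrite fcoef_dil fcoef_half // fcoefD fcoef_dil /= -signr_odd.
by case: odd => /=; field; rewrite two_neq0 qfact_neq0.
Qed.

Lemma sinh_coef n :
  fcoef (fps_dil M (sinh_q q)) n = (odd n)%:R * M ^+ n / qfact n q.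
Proof.
rewrite fcoef_dil fcoef_half // fcoefB fcoef_dil /= -signr_odd.
by case: odd => /=; field; rewrite two_neq0 qfact_neq0.
Qed.

Lemma coshD_coef n :
  fcoef (fps_dil M (cosh_D q)) n = (~~ odd n)%:R * M ^+ n / Dpoly1 n q.
Proof.
rewrite fcoef_dil fcoef_half // fcoefD fcoef_dil /= -signr_odd.
by case: odd => /=; field; rewrite two_neq0 Dpoly1_neq0.
Qed.

Lemma sinhD_coef n :
  fcoef (fps_dil M (sinh_D q)) n = (odd n)%:R * M ^+ n / Dpoly1 n q.
Proof.
rewrite fcoef_dil fcoef_half // fcoefB fcoef_dil /= -signr_odd.
by case: odd => /=; field; rewrite two_neq0 Dpoly1_neq0.
Qed.

(** The factors alternate between 1 - s and 1 - t, and two consecutive ones give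
M^2. *)
Lemma asc_prod_even_len m b : ~~ odd b -> asc_prod c m.+1 (m + b).+1 = M ^+ b.
Proof.
move=> even_b; rewrite -(odd_double_half b) (negPf even_b) add0n.
elim: b./2 => [|k IHk]; first by rewrite addn0 /asc_prod big_geq.
have le_m : (m < (m + k.*2).+1)%N by rewrite ltnS leq_addr.
rewrite /asc_prod in IHk *; rewrite doubleS !addnS.
rewrite big_nat_recr /=; last exact: ltnW.
rewrite big_nat_recr //= IHk /Dweight /= -mulrA !exprS.
rewrite [X in _ = X]mulrA -[M * M]expr2.
rewrite M_sq oddD odd_double addbF.
by case: (odd m) => /=; ring.
Qed.

Lemma asc_prod_odd_len m b : odd b ->
  asc_prod c m.+1 (m + b).+1 = M ^+ b.-1 * (if odd m then 1 - s else 1 - t).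
Proof.
case: b => // b odd_b; rewrite addnS -addSn /asc_prod big_ltn; last by lia.
rewrite -/(asc_prod _ _ _) asc_prod_even_len // mulrC /Dweight /=.
by case: (odd m).
Qed.

Let C := fps_dil M (cosh_q q).
Let S := fps_dil M (sinh_q q).
Let D0 := Dgen0 s t q.
Let D1 := Dgen1 s t q.

Lemma D0_coef n : fcoef D0 n =
  if ~~ odd n && (1 < n)%N then ratio n else 0.
Proof. by case: n => [|[]]. Qed.

Lemma D1_coef n : fcoef D1 n = if odd n && (1 < n)%N then ratio n else 0.
Proof. by []. Qed.

Lemma asc_block i n : (i < n)%N ->
  asc_prod c i.+1 n =
  M ^+ (n - i) / (if odd (n - i) then M else if odd i then 1 - t else 1 - s).
Proof.
move=> lt_in; have [b ->] : exists b, n = (i + b).+1.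
  by exists (n - i.+1)%N; rewrite -addSn subnKC.
rewrite -addnS addKn addnS /=; case: (boolP (odd b)) => odd_b /=.
  rewrite asc_prod_odd_len //; case: b odd_b => // b _ /=.
  rewrite !exprS [M * (M * _)]mulrA -[M * M]expr2 M_sq.
  by case: odd; field.
by rewrite asc_prod_even_len // exprS; field.
Qed.

Lemma coshB1_coef n :
  fcoef (C - 1) n = (~~ odd n && (0 < n)%N)%:R * M ^+ n / qfact n q.
Proof.
rewrite fcoefB cosh_coef fcoef1; case: n => [|n] /=.
  by rewrite qfact0 expr0 mul1r divr1 subrr mul0r mul0r.
by rewrite subr0 andbT.
Qed.

(** One block in the coefficient of u^n: the parities of n and of the position i
determine which of the two hyperbolic series describes it, and in odd degree
both products vanish. *)
Lemma even_block n i : (i <= n)%N ->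
  s * (fcoef D0 i * fcoef (C - 1) (n - i)) +
  t * (1 - s) / M * (fcoef D1 i * fcoef S (n - i)) =
  (~~ odd n && (1 < i < n)%N)%:R *
    ((1 - s) * (c i * asc_prod c i.+1 n * ratio i / qfact (n - i) q)).
Proof.
move=> le_in; rewrite D0_coef D1_coef coshB1_coef sinh_coef subn_gt0.
have -> : odd n = odd (n - i) (+) odd i by rewrite -oddD subnK.
case: (ltnP 1 i) => [i_gt1|_]; last by rewrite !andbF /= !mul0r !mulr0 addr0.
case: (ltnP i n) => [lt_in|le_ni]; last first.
  have -> : (n - i = 0)%N by apply/eqP; rewrite subn_eq0.
  by rewrite !andbF /= !mul0r !mulr0 addr0.
rewrite asc_block // /Dweight; have := qfact_neq0 (n - i).
case: i i_gt1 {le_in lt_in} => // i _.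
set Q := qfact _ q => Q_neq0; set P := M ^+ _; have := Dpoly1_neq0 i.+1.
set R := Dpoly1 _ q => R_neq0; set N := Dpoly _ _ _ _.
by case: (odd (n - _)); case: (odd _) => /=; field;
  rewrite ?M_neq0 ?Q_neq0 ?R_neq0 ?s_neq1 ?t_neq1.
Qed.

Lemma odd_block n i : (i <= n)%N ->
  t * (fcoef D1 i * fcoef (C - 1) (n - i)) +
  s * (1 - t) / M * (fcoef D0 i * fcoef S (n - i)) =
  (odd n && (1 < i < n)%N)%:R *
    ((1 - t) * (c i * asc_prod c i.+1 n * ratio i / qfact (n - i) q)).
Proof.
move=> le_in; rewrite D0_coef D1_coef coshB1_coef sinh_coef subn_gt0.
have -> : odd n = odd (n - i) (+) odd i by rewrite -oddD subnK.
case: (ltnP 1 i) => [i_gt1|_]; last by rewrite !andbF /= !mul0r !mulr0 addr0.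
case: (ltnP i n) => [lt_in|le_ni]; last first.
  have -> : (n - i = 0)%N by apply/eqP; rewrite subn_eq0.
  by rewrite !andbF /= !mul0r !mulr0 addr0.
rewrite asc_block // /Dweight; have := qfact_neq0 (n - i).
case: i i_gt1 {le_in lt_in} => // i _.
set Q := qfact _ q => Q_neq0; set P := M ^+ _; have := Dpoly1_neq0 i.+1.
set R := Dpoly1 _ q => R_neq0; set N := Dpoly _ _ _ _.
by case: (odd (n - _)); case: (odd _) => /=; field;
  rewrite ?M_neq0 ?Q_neq0 ?R_neq0 ?s_neq1 ?t_neq1.
Qed.

Lemma sum_blocks n (F : nat -> K) b :
  \sum_(i < n.+1) (b && (1 < i < n)%N)%:R * F i = b%:R * \sum_(2 <= m < n) F m.
Proof.
case: b; last by rewrite mul0r big1 // => i _; rewrite mul0r.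
rewrite mul1r (big_nat_widenl 2 0) // (@big_nat_widen _ _ _ 0 n n.+1) //=.
rewrite big_mkord [in RHS]big_mkcond /=; apply: eq_bigr => i _.
by case: ifP; rewrite ?mul1r ?mul0r.
Qed.

Lemma even_blocks n :
  s * fcoef (D0 * (C - 1)) n + t * (1 - s) / M * fcoef (D1 * S) n =
  (~~ odd n)%:R * ((1 - s) *
    \sum_(2 <= m < n) c m * asc_prod c m.+1 n * ratio m / qfact (n - m) q).
Proof.
rewrite [in RHS]mulr_sumr -sum_blocks !fcoefM !mulr_sumr -big_split.
by apply: eq_bigr => i _; apply: even_block; rewrite leq_ord.
Qed.

Lemma odd_blocks n :
  t * fcoef (D1 * (C - 1)) n + s * (1 - t) / M * fcoef (D0 * S) n =
  (odd n)%:R * ((1 - t) *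
    \sum_(2 <= m < n) c m * asc_prod c m.+1 n * ratio m / qfact (n - m) q).
Proof.
rewrite [in RHS]mulr_sumr -sum_blocks !fcoefM !mulr_sumr -big_split.
by apply: eq_bigr => i _; apply: odd_block; rewrite leq_ord.
Qed.

(** The recurrence for even n, multiplied by 1 - s. *)
Lemma even_equation :
  D0 * (1 - fpsC s * C) =
  fpsC (2 * t) * (C - 1) + fpsC (1 - t) * (fps_dil M (cosh_D q) - 1)
    + fpsX K * fpsC (t ^+ 2 * (1 - s) / M) * S
  + D1 * (fpsC (t * (1 - s) / M) * S).
Proof.
suff eqD : fpsC (1 - s) * D0 = fpsC (2 * t) * (C - 1)
    + fpsC (1 - t) * (fps_dil M (cosh_D q) - 1)
    + fpsC (t ^+ 2 * (1 - s) / M) * (fpsX K * S)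
    + (fpsC s * (D0 * (C - 1)) + fpsC (t * (1 - s) / M) * (D1 * S)).
  have -> : D0 * (1 - fpsC s * C) = fpsC (1 - s) * D0 - fpsC s * (D0 * (C - 1)).
    by rewrite fpsCB fpsC1; ring.
  by rewrite eqD; ring.
apply/fpsP => n; rewrite !fcoefD !fcoefCM coshB1_coef fcoefB coshD_coef fcoef1.
rewrite even_blocks D0_coef.
case: n => [|[|n]].
- rewrite fcoefXM0 Dpoly1_0 big_geq //= expr0 divr1; ring.
- by rewrite fcoefXM sinh_coef /=; ring.
rewrite fcoefXM sinh_coef ratio_recurrence //= andbT negbK.
case: (boolP (odd n)) => odd_n /=; first by ring.
have -> : asc_prod c 2 n.+2 = M ^+ n.
  by rewrite -[n in LHS]add0n -addSn asc_prod_even_len.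
rewrite !mul1r subr0 mulrDr; congr (_ + _).
have := Dpoly1_neq0 n.+2; have := qfact_neq0 n.+2; have := qfact_neq0 n.+1.
have -> : M ^+ n.+2 = M ^+ n * ((1 - s) * (1 - t)).
  by rewrite -M_sq -exprD addn2.
have -> : M ^+ n.+1 = M ^+ n * M by rewrite exprSr.
move: (M ^+ n) (qfact _ q) (qfact _ q) (Dpoly1 _ q).
move=> P Q1 Q2 R Q1_neq0 Q2_neq0 R_neq0.
by field; rewrite ?M_neq0 ?Q1_neq0 ?Q2_neq0 ?R_neq0.
Qed.

(** The recurrence for odd n, multiplied by 1 - t.  In degree 1 the subtracted
terms Mu cancel the series, since D_1(1,q) = [1]_q! = 1. *)
Lemma odd_equation :
  D1 * (1 - fpsC t * C) =
  fpsX K * fpsC (t ^+ 2) * (C - 1)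
    + fpsC ((1 - t) * M / (1 - s)) * (fps_dil M (sinh_D q) - fpsC M * fpsX K)
    + fpsC (2 * t * (1 - t) / M) * (S - fpsC M * fpsX K)
  + D0 * (fpsC (s * (1 - t) / M) * S).
Proof.
suff eqD : fpsC (1 - t) * D1 = fpsC (t ^+ 2) * (fpsX K * (C - 1))
    + fpsC ((1 - t) * M / (1 - s)) * (fps_dil M (sinh_D q) - fpsC M * fpsX K)
    + fpsC (2 * t * (1 - t) / M) * (S - fpsC M * fpsX K)
    + (fpsC t * (D1 * (C - 1)) + fpsC (s * (1 - t) / M) * (D0 * S)).
  have -> : D1 * (1 - fpsC t * C) = fpsC (1 - t) * D1 - fpsC t * (D1 * (C - 1)).
    by rewrite fpsCB fpsC1; ring.
  by rewrite eqD; ring.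
apply/fpsP => n; rewrite !fcoefD !fcoefCM !fcoefB !fcoefCM fcoefX.
rewrite sinh_coef sinhD_coef odd_blocks D1_coef.
case: n => [|[|n]].
- by rewrite fcoefXM0 big_geq //=; ring.
- rewrite big_geq // fcoefXM coshB1_coef Dpoly1_1 qfact1 /= !divr1.
  by ring.
rewrite fcoefXM coshB1_coef ratio_recurrence //= andbT.
rewrite negbK; case: (boolP (odd n)) => odd_n; last by rewrite /=; ring.
have -> : asc_prod c 2 n.+2 = M ^+ n.-1 * (1 - s).
  by rewrite -[n in LHS]add0n -addSn asc_prod_odd_len.
rewrite mulrDr; congr (_ + _); last by rewrite mul1r.
case: n odd_n => // n _ /=; have := Dpoly1_neq0 n.+3.
have := qfact_neq0 n.+3; have := qfact_neq0 n.+2.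
have -> : M ^+ n.+3 = M ^+ n * ((1 - s) * (1 - t)) * M.
  by rewrite -M_sq -exprD addn2 exprSr.
have -> : M ^+ n.+2 = M ^+ n * ((1 - s) * (1 - t)).
  by rewrite -M_sq -exprD addn2.
move: (M ^+ n) (qfact _ q) (qfact _ q) (Dpoly1 _ q).
move=> P Q1 Q2 R Q1_neq0 Q2_neq0 R_neq0.
by field: M_sq; rewrite ?M_neq0 ?Q1_neq0 ?Q2_neq0 ?R_neq0 ?s_neq1.
Qed.

Lemma exp_q_dilM : fps_dil M (exp_q q) = C + S.
Proof.
apply/fpsP => n; rewrite fcoefD cosh_coef sinh_coef fcoef_dil /=.
by case: odd => /=; ring.
Qed.

Lemma exp_q_dilN : fps_dil (- M) (exp_q q) = C - S.
Proof.
apply/fpsP => n; rewrite fcoefB cosh_coef sinh_coef fcoef_dil /=.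
rewrite exprNn -signr_odd.
by case: odd => /=; ring.
Qed.

(** Stated for scalars s, t, q, so that the indeterminates enter only through the
nonvanishing of the denominators. *)
Theorem D_generating_functions :
  let u : fps K := fpsX K in
  let cosh_qMu := fps_dil M (cosh_q q) in
  let sinh_qMu := fps_dil M (sinh_q q) in
  let cosh_DMu := fps_dil M (cosh_D q) in
  let sinh_DMu := fps_dil M (sinh_D q) in
  let OD : fps K :=
    u * fpsC (t ^+ 2) * (cosh_qMu - 1)
    + fpsC ((1 - t) * M / (1 - s)) * (sinh_DMu - fpsC M * u)
    + fpsC (2 * t * (1 - t) / M) * (sinh_qMu - fpsC M * u) in
  let ED : fps K :=
    fpsC (2 * t) * (cosh_qMu - 1)
    + fpsC (1 - t) * (cosh_DMu - 1)
    + u * fpsC (t ^+ 2 * (1 - s) / M) * sinh_qMu in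
  let den : fps K :=
    1 - fpsC (s + t) * cosh_qMu
    + fpsC (s * t) * fps_dil M (exp_q q) * fps_dil (- M) (exp_q q) in
  Dgen0 s t q
    = (ED * (1 - fpsC t * cosh_qMu)
       + OD * fpsC (t * (1 - s) / M) * sinh_qMu) / den
  /\
  Dgen1 s t q
    = (OD * (1 - fpsC s * cosh_qMu)
       + ED * fpsC (s * (1 - t) / M) * sinh_qMu) / den.
Proof.
move=> u cosh_qMu sinh_qMu cosh_DMu sinh_DMu OD ED den.
set al := fpsC (t * (1 - s) / M); set be := fpsC (s * (1 - t) / M).
have coshE : cosh_qMu = C by [].
have sinhE : sinh_qMu = S by [].
(* The product of the off-diagonal coefficients, by M^2 = (1 - s)(1 - t). *)
have albe : al * be = fpsC s * fpsC t.
  rewrite -!fpsCM; congr fpsC; field: M_sq; exact: M_neq0.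
have eq0 : ED = D0 * (1 - fpsC s * C) - D1 * (al * S).
  by rewrite even_equation addrK.
have eq1 : OD = D1 * (1 - fpsC t * C) - D0 * (be * S).
  by rewrite odd_equation addrK.
have den0 : fcoef den 0 != 0.
  rewrite /den exp_q_dilM exp_q_dilN fcoefD fcoefB -mulrA !fcoefCM fcoefM.
  rewrite big_ord1 fcoefD fcoefB.
  rewrite fcoef1 cosh_coef sinh_coef qfact0 expr0 /=.
  have -> : 1 - (s + t) * (1 * 1 / 1) + s * t *
    ((1 * 1 / 1 + 0 * 1 / 1) * (1 * 1 / 1 - 0 * 1 / 1)) = (1 - s) * (1 - t).
    by rewrite divr1; ring.
  exact: mulf_neq0.
have denE : den = (1 - fpsC s * C) * (1 - fpsC t * C) - al * be * S * S.
  by rewrite albe /den exp_q_dilM exp_q_dilN coshE fpsCD fpsCM; ring.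
by split; apply: fps_eq_div => //;
  rewrite denE eq0 eq1 coshE sinhE -/D0 -/D1; ring.
Qed.


End GeneratingFunctions.

(** * Nonvanishing over the field of rational functions *)

Section Indeterminates.
Variable K : fieldExtType Qstq.

Let P := {mpoly rat[3]}.
Let of_mpoly : P -> K := in_alg K \o @tofrac P.
HB.instance Definition _ := GRing.RMorphism.copy of_mpoly (in_alg K \o @tofrac P).

(** Polynomials embed into the field, and one with a nonzero value is nonzero. *)
Lemma of_mpoly_neq0 (p : P) (v : 'I_3 -> rat) : p.@[v] != 0 -> of_mpoly p != 0.
Proof.
move=> pv; rewrite /of_mpoly /= scaler_eq0 oner_eq0 orbF tofrac_eq0.
by apply: contraNneq pv => ->; rewrite meval0.
Qed.

Lemma one_sub_s_neq0 : 1 - s_var%:A != 0 :> K.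
Proof.
have -> : 1 - s_var%:A = of_mpoly (1 - 'X_0) by rewrite rmorphB rmorph1.
apply: (@of_mpoly_neq0 _ (fun=> 0)).
by rewrite mevalB meval1 mevalXU subr0 oner_eq0.
Qed.

Lemma one_sub_t_neq0 : 1 - t_var%:A != 0 :> K.
Proof.
have -> : 1 - t_var%:A = of_mpoly (1 - 'X_1) by rewrite rmorphB rmorph1.
apply: (@of_mpoly_neq0 _ (fun=> 0)).
by rewrite mevalB meval1 mevalXU subr0 oner_eq0.
Qed.

Lemma natr_neq0 n : n.+1%:R != 0 :> K.
Proof.
have -> : n.+1%:R = of_mpoly n.+1%:R by rewrite rmorph_nat.
apply: (@of_mpoly_neq0 _ (fun=> 0)); rewrite rmorph_nat.
by rewrite pnatr_eq0.
Qed.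

Lemma qint_neq0 n : qint n.+1 (q_var%:A : K) != 0.
Proof.
have -> : qint n.+1 (q_var%:A : K) = of_mpoly (\sum_(i < n.+1) 'X_2 ^+ i).
  by rewrite rmorph_sum; apply: eq_bigr => i _; rewrite rmorphXn.
apply: (@of_mpoly_neq0 _ (fun=> 1)); rewrite rmorph_sum.
under eq_bigr do rewrite rmorphXn /= mevalXU expr1n.
by rewrite sumr_const card_ord pnatr_eq0.
Qed.

Lemma one_add_q_neq0 n : 1 + (q_var%:A : K) ^+ n != 0.
Proof.
have -> : 1 + (q_var%:A : K) ^+ n = of_mpoly (1 + 'X_2 ^+ n).
  by rewrite rmorphD rmorph1 rmorphXn.
apply: (@of_mpoly_neq0 _ (fun=> 1)).
by rewrite mevalD meval1 rmorphXn /= mevalXU expr1n (pnatr_eq0 _ 2).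
Qed.

End Indeterminates.

Theorem theorem8 (K : fieldExtType Qstq) (M : K) :
  let s : K := s_var%:A in
  let t : K := t_var%:A in
  let q : K := q_var%:A in
  let u : fps K := fpsX K in
  let cosh_qMu := fps_dil M (cosh_q q) in
  let sinh_qMu := fps_dil M (sinh_q q) in
  let cosh_DMu := fps_dil M (cosh_D q) in
  let sinh_DMu := fps_dil M (sinh_D q) in
  let e_qMu := fps_dil M (exp_q q) in
  let e_qNMu := fps_dil (- M) (exp_q q) in
  let OD : fps K :=
    u * fpsC (t ^+ 2) * (cosh_qMu - 1)
    + fpsC ((1 - t) * M / (1 - s)) * (sinh_DMu - fpsC M * u)
    + fpsC (2 * t * (1 - t) / M) * (sinh_qMu - fpsC M * u) in
  let ED : fps K :=
    fpsC (2 * t) * (cosh_qMu - 1)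
    + fpsC (1 - t) * (cosh_DMu - 1)
    + u * fpsC (t ^+ 2 * (1 - s) / M) * sinh_qMu in
  let den : fps K :=
    1 - fpsC (s + t) * cosh_qMu + fpsC (s * t) * e_qMu * e_qNMu in
  M ^+ 2 = (1 - s) * (1 - t) ->
  Dgen0 s t q
    = (ED * (1 - fpsC t * cosh_qMu)
       + OD * fpsC (t * (1 - s) / M) * sinh_qMu) / den
  /\
  Dgen1 s t q
    = (OD * (1 - fpsC s * cosh_qMu)
       + ED * fpsC (s * (1 - t) / M) * sinh_qMu) / den.
Proof.
move=> s t q u cosh_qMu sinh_qMu cosh_DMu sinh_DMu e_qMu e_qNMu OD ED den M_sq.
apply: D_generating_functions => // [|n|n||].
- exact: (natr_neq0 K 1).
- rewrite /qfact big_add1 prodf_seq_neq0; apply/allP => j _.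
  exact: qint_neq0.
- rewrite prodf_seq_neq0; apply/allP => j _.
  by rewrite mulf_neq0 ?one_add_q_neq0 ?qint_neq0.
- exact: one_sub_s_neq0.
- exact: one_sub_t_neq0.
Qed.
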